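(* Consider the linear model $Y=X\beta+\epsilon$, $\epsilon\sim N(0,\sigma^2I_n)$, with random $n\times p$ design $X$ having i.i.d. rows $\sim N(0,\Sigma)$, where $n\le p<e^{n/(4C_2^2)}$ and $C_2>4\sqrt{5/3}$. Suppose that Assumption $RE(s,s,3,\Sigma)$ holds. Set $K=\sqrt2\,K(s,s,3,\Sigma)$, $c_0=\sqrt{3/2}$, $\lambda_{\mathrm{init}}=\sqrt{24}\,c_0\sigma\sqrt{\log p/n}$, $\beta_{\mathrm{init}}=\arg\min_b\frac1{2n}\|Y-Xb\|_2^2+\lambda_{\mathrm{init}}\|b\|_1$, and $\bar s=|\{j:|\beta_{j,\mathrm{init}}|>4\lambda_{\mathrm{init}}\}|$. Suppose that on the set $\mathcal{X}\cap\mathcal{T}$, for some $0<\eta<1$ and some constant $M$ with $$\frac{4K}{\eta}\le M\le\frac{\sqrt{\Lambda_{\min}(s)}}{(1-\eta)c_0\sigma}\sqrt{\frac{n}{2\log p}},$$ $\lambda_n$ is chosen such that $$16MK\ \ge\ \frac{\lambda_n}{c_0\sigma\lambda_{\mathrm{init}}\sqrt{\bar s}}\sqrt{\frac{n}{2\log(p-s)}}\ \ge\ \frac{64K^2}{\eta}.$$ Suppose that $$s\le\frac{1}{32K^2(s,s,3,\Sigma)}\min\left\{\frac1{C_2},\frac{\sqrt{\Lambda_{\min}(s)}(1-\eta)}{6\sqrt6\,\sigma}\right\}\sqrt{\frac{n}{\log p}}$$ and $$\beta_{\min}>\max\left\{\frac{2\sqrt s}{(1-\eta)\sqrt{\Lambda_{\min}(s)}},\frac{M}{\sqrt3}\right\}16K^2\lambda_{\mathrm{init}}\sqrt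 s.$$ Then, with probability at least $1-3/p^2$, the adaptive Lasso estimator $\hat\beta=\arg\min_b\frac1{2n}\|Y-Xb\|_2^2+\lambda_n\sum_{j=1}^pw_j|b_j|$ with weights $w_j=\max\{1/|\beta_{j,\mathrm{init}}|,1\}$ satisfies $\mathrm{supp}(\hat\beta)=\mathrm{supp}(\beta)$.
   Context: $S:=\mathrm{supp}(\beta)=\{j:\beta_j\ne0\}$, $s:=|S|$, $\beta_{\min}:=\min_{j\in S}|\beta_j|$; $\gamma_J$ is the subvector of $\gamma$ indexed by $J$. $X$ is independent of $\epsilon$. If $\beta_{j,\mathrm{init}}=0$ then $w_j=\infty$, meaning the $j$-th coordinate is constrained to be $0$. $\mathcal{X}:=\left\{\max_{j,k}|\Delta_{jk}|<C_2\sqrt{\log p/n}\right\}$ with $\Delta=X^TX/n-\Sigma$. $\mathcal{T}:=\left\{\|X^T\epsilon/n\|_\infty\le c_0\sigma\sqrt{6\log p/n}\right\}$ ($\|\cdot\|_\infty$ = maximum absolute entry). $\Lambda_{\min}(s):=\frac{16}{17}\min_{J_0\subseteq\{1,\dots,p\},|J_0|\le s}\ \min_{\gamma\ne0,\ \gamma_{J_0^c}=0}\frac{\gamma^T\Sigma\gamma}{\|\gamma_{J_0}\|_2^2}$. Assumption $RE(s,m,k_0,\Sigma)$ (integers $1\le s\le p/2$, $m\ge s$, $s+m\le p$, $k_0>0$): $\Sigma_{jj}=1$ for all $j$, $\Lambda_{\min}(\Sigma_{SS})\ge\frac{17\Lambda_{\min}(s)}{16}>0$ ($\Lambda_{\min}(A)$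 of a symmetric matrix is its smallest eigenvalue; $\Sigma_{SS}$ is the submatrix with rows and columns in $S$), and $$\frac{1}{K(s,m,k_0,\Sigma)}:=\min_{J_0\subseteq\{1,\dots,p\},|J_0|\le s}\ \min_{\gamma\neq0,\ \|\gamma_{J_0^c}\|_1\le k_0\|\gamma_{J_0}\|_1}\frac{\|\Sigma^{1/2}\gamma\|_2}{\|\gamma_{J_{0m}}\|_2}>0,$$ where $J_{0m}=J_0\cup J_m$ and $J_m$ is the set of the $m$ coordinates of $\gamma$ outside $J_0$ that are largest in absolute value. *)

(* Defs.v *)
(* MathComp-Analysis *)
From HB Require Import structures.
From mathcomp Require Import all_boot all_order all_algebra.
From mathcomp Require Import all_classical all_reals all_analysis.
Set Implicit Arguments.
Unset Strict Implicit.
Unset Printing Implicit Defensive.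
Import Order.TTheory GRing.Theory Num.Theory.
Import numFieldNormedType.Exports.
Local Open Scope classical_set_scope.
Local Open Scope ring_scope.

Section Vectors.
Context {R : realType}.

Definition l1norm (m : nat) (v : 'cV[R]_m) : R := \sum_i `|v i 0|.

Definition l2norm (m : nat) (v : 'cV[R]_m) : R := Num.sqrt (\sum_i v i 0 ^+ 2).

Definition supp (m : nat) (v : 'cV[R]_m) : {set 'I_m} :=
  [set j | v j 0 != 0]%SET.

Definition subvec (m : nat) (J : {set 'I_m}) (v : 'cV[R]_m) : 'cV[R]_#|J| :=
  \col_i v (enum_val i) 0.

Definition subsqmx (m : nat) (J : {set 'I_m}) (A : 'M[R]_m) : 'M[R]_#|J| :=
  \matrix_(i, j) A (enum_val i) (enum_val j).

Definition quadform (m : nat) (A : 'M[R]_m) (v : 'cV[R]_m) : R :=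
  (v^T *m A *m v) 0 0.

Definition beta_min (m : nat) (v : 'cV[R]_m) : R :=
  inf [set `|v j 0| | j in [set` supp v]].

Definition is_psd (m : nat) (A : 'M[R]_m) : Prop :=
  A^T = A /\ forall v, 0 <= quadform A v.

(* The positive semidefinite square root; it exists and is unique when A is
   positive semidefinite, and the default value 0 is used otherwise. *)
Definition sqrtmx (m : nat) (A : 'M[R]_m) : 'M[R]_m :=
  xget 0 [set B | is_psd B /\ B *m B = A].

(* The set of eigenvalues is finite, so inf is a minimum whenever the set is
   nonempty, in particular for a symmetric matrix of positive size. *)
Definition min_eigenvalue (m : nat) (A : 'M[R]_m) : R :=
  inf [set a | eigenvalue A a].

Definition argmin (V : Type) (D : set V) (f : V -> R) (x : V) : Prop :=
  D x /\ forall y, D y -> f x <= f y.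

End Vectors.

Section RestrictedEigenvalues.
Context {R : realType} {p : nat}.
Implicit Types (Sigma : 'M[R]_p) (J : {set 'I_p}) (g : 'cV[R]_p).

(* The quotients below are homogeneous of degree 0 and continuous on closed
   cones, so the infima over nonempty sets are attained, i.e. are minima. *)
Definition Lambda_min Sigma (s : nat) : R :=
  16 / 17 * inf [set r | exists J0 g, [/\ (#|J0| <= s)%N, g != 0,
    subvec (~: J0)%SET g = 0 &
    r = quadform Sigma g / l2norm (subvec J0 g) ^+ 2]].

(* Ties in absolute value may be broken arbitrarily: the norm of the subvector
   on J0 :|: Jm does not depend on the choice. *)
Definition m_largest_outside (m : nat) J0 g (Jm : {set 'I_p}) : Prop :=
  [/\ Jm \subset (~: J0)%SET, #|Jm| = m &
      forall j k, j \in Jm -> k \notin J0 -> k \notin Jm ->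
        `|g k 0| <= `|g j 0|].

Definition RE_invK (s m : nat) (k0 : R) Sigma : R :=
  inf [set r | exists J0 g Jm, [/\ (#|J0| <= s)%N, g != 0,
    l1norm (subvec (~: J0)%SET g) <= k0 * l1norm (subvec J0 g),
    m_largest_outside m J0 g Jm &
    r = l2norm (sqrtmx Sigma *m g) / l2norm (subvec (J0 :|: Jm)%SET g)]].

Definition RE_K (s m : nat) (k0 : R) Sigma : R := (RE_invK s m k0 Sigma)^-1.

Record RE_assumption (S : {set 'I_p}) (s m : nat) (k0 : R) Sigma : Prop := {
  RE_s_gt0 : (1 <= s)%N;
  RE_s_half : (2 * s <= p)%N;
  RE_m_ge : (s <= m)%N;
  RE_sm : (s + m <= p)%N;
  RE_k0 : 0 < k0;
  RE_diag : forall j, Sigma j j = 1;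
  RE_eig : 17 * Lambda_min Sigma s / 16 <= min_eigenvalue (subsqmx S Sigma);
  RE_Lambda_gt0 : 0 < 17 * Lambda_min Sigma s / 16;
  RE_invK_gt0 : 0 < RE_invK s m k0 Sigma }.

End RestrictedEigenvalues.

Section Probability.
Context {d : measure_display} {T : measurableType d} {R : realType}.
Variable P : probability T R.

(* The law N(m, v) on the line, parametrized by the variance v >= 0.  For a
   zero standard deviation the library's normal_prob is the uniform law on
   [0, 1], not a Dirac mass, whence the case distinction. *)
Definition normal_law (m v : R) (B : set R) : \bar R :=
  if v == 0 then \d_m B else normal_prob m (Num.sqrt v) B.

(* Z ~ N(0, Sigma): every linear combination of the coordinates of Z is a
   centred normal variable.  Singular Sigma are allowed. *)
Definition centered_gaussian (m : nat) (Sigma : 'M[R]_m) (Z : T -> 'cV[R]_m)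
    : Prop :=
  is_psd Sigma /\
  forall a : 'cV[R]_m, let U := fun w : T => (a^T *m Z w) 0 0 in
    measurable_fun [set: T] U /\
    forall B : set R, measurable B ->
      pushforward P U B = normal_law 0 (quadform Sigma a) B.

Definition sigma_generated (m n : nat) (Z : T -> 'M[R]_(m, n))
    : set (set T) :=
  <<s [set A | exists i j (B : set R),
        measurable B /\ A = (fun w => Z w i j) @^-1` B] >>.

Definition mutually_independent (I : finType) (F : I -> set (set T)) : Prop :=
  forall (J : {set I}) (A : I -> set T), (forall i, i \in J -> F i (A i)) ->
    P (\bigcap_(i in [set` J]) A i) = (\prod_(i in J) P (A i))%E.

Definition independent2 (F G : set (set T)) : Prop :=
  forall A B, F A -> G B -> P (A `&` B) = (P A * P B)%E.

Definition iid_gaussian_rows (n p : nat) (Sigma : 'M[R]_p)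
    (X : T -> 'M[R]_(n, p)) : Prop :=
  (forall i, centered_gaussian Sigma (fun w => (row i (X w))^T)) /\
  mutually_independent (fun i => sigma_generated (fun w => row i (X w))).

(* A is not assumed to be measurable (an argmin of a Lasso objective need not
   be unique, nor selected measurably); if it is measurable, this amounts to
   r%:E <= P A. *)
Definition with_probability_at_least (r : R) (A : set T) : Prop :=
  exists2 E : set T, measurable E /\ E `<=` A & (r%:E <= P E)%E.

End Probability.

Section Lasso.
Context {R : realType} {n p : nat}.
Implicit Types (X : 'M[R]_(n, p)) (Y : 'cV[R]_n) (b binit : 'cV[R]_p).

Definition is_lasso X Y (lambda : R) b : Prop :=
  argmin [set: 'cV[R]_p]
    (fun b => (2 * n%:R)^-1 * l2norm (Y - X *m b) ^+ 2 + lambda * l1norm b) b.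

Definition ada_weight binit (j : 'I_p) : \bar R :=
  if binit j 0 == 0 then +oo%E else (Num.max (1 / `|binit j 0|) 1)%:E.

(* An infinite weight constrains the coordinate to be 0; in the objective such
   a coordinate then contributes fine +oo * 0 = 0. *)
Definition is_adaptive_lasso X Y (lambda : R) (w : 'I_p -> \bar R) b : Prop :=
  argmin [set b : 'cV[R]_p | forall j, w j = +oo%E -> b j 0 = 0]
    (fun b => (2 * n%:R)^-1 * l2norm (Y - X *m b) ^+ 2 +
              lambda * \sum_j fine (w j) * `|b j 0|) b.

End Lasso.

Section Events.
Context {d : measure_display} {T : measurableType d} {R : realType}.
Context {n p : nat}.

(* mx_norm is the maximum absolute entry. *)
Definition event_X (X : T -> 'M[R]_(n, p)) (Sigma : 'M[R]_p) (C2 : R)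
    : set T :=
  [set w | mx_norm (n%:R^-1 *: ((X w)^T *m X w) - Sigma)
             < C2 * Num.sqrt (ln p%:R / n%:R)].

Definition event_T (X : T -> 'M[R]_(n, p)) (eps : T -> 'cV[R]_n)
    (c0 sigma : R) : set T :=
  [set w | mx_norm (n%:R^-1 *: ((X w)^T *m eps w))
             <= c0 * sigma * Num.sqrt (6 * ln p%:R / n%:R)].

End Events.

(* Main.v *)
Require Import Defs.
From HB Require Import structures.
From mathcomp Require Import all_boot all_order all_algebra.
From mathcomp Require Import all_classical all_reals all_analysis.
From mathcomp Require Import measurable_realfun zify ring lra.
Set Implicit Arguments.
Unset Strict Implicit.
Unset Printing Implicit Defensive.
Import Order.TTheory GRing.Theory Num.Theory.
Import numFieldNormedType.Exports.
Local Open Scope classical_set_scope.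
Local Open Scope ring_scope.

(** The estimator recovers the support on an event that is described by three
    finite families of inequalities, and the rest of the proof bounds the
    probability that one of them fails.  Write G for the Gram matrix X^T X / n,
    z for X^T eps / n, S for the support of beta, s for its size, and kappa for
    the reciprocal of K(s,s,3,Sigma), so that K^2 = 2 / kappa^2.

    The good event asks for
    - |G_jk - Sigma_jk| <= t = 4 sqrt(5/3) sqrt(ln p / n) for all j, k;
    - |z_j| <= c0 sigma sqrt(6 ln p / n) for all j, which is half of
      lambda_init;
    - |r_j^T z| <= c0 sigma sqrt(8 ln p / n) for all j, where X r_j is the
      residual of column j after projection onto the columns in S
      (residual_coef).
    The first two families put the sample in the two events under which the
    bounds on lambda_n are assumed.  The third one is what keeps the projected
    noise under control: bounding it through the second family alone would
    cost a factor sqrt(s).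

    On the good event the argument is deterministic.  The sparsity condition
    gives s t <= kappa^2 / 32, so passing from Sigma to G loses at most half of
    the restricted eigenvalue (gram_RE) and none of the sparse eigenvalue
    Lambda_min(s), thanks to the factor 16/17 in its definition
    (gram_sparse_bound).  The basic inequality of the Lasso then bounds each
    coordinate of the error of beta_init by 3 K^2 lambda_init sqrt(s)
    (lasso_sup_error) and its l1 norm outside S by
    (9/4) K^2 lambda_init s (lasso_l1_off_support); hence
    s <= sbar <= s (1 + 9 K^2 / 16), the weights are large outside S and
    controlled on S.  For the adaptive Lasso a candidate with support S is
    written down explicitly and shown to satisfy the optimality conditions
    with strict inequality outside S; by convexity every minimizer then equals
    it (adaptive_lasso_unique, adaptive_lasso_support).  The remaining
    inequalities between the tuning constants are isolated in the signal,
    incoherence and noise lemmas of the arithmetic part.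

    For the probability, X_ij X_ik is one quarter of the difference of
    (X_ij + X_ik)^2 and (X_ij - X_ik)^2, so the first family follows from
    chi-square tails exp(- n t^2 / 6) with n t^2 = (80/3) ln p; the p^2 pairs
    cost 4 p^2 p^(-40/9).  Given X, the quantities z_j and r_j^T z are centred
    normal with variance at most c0^2 sigma^2 / n on the first family
    (conditional_noise_tail), so the other two cost 2 p^(-2) and 2 p^(-3).
    The sum is below 3 p^(-2) as soon as p >= 213, and the assumption
    n <= p < exp(n / (4 C2^2)) forces p to be that large. *)

(** * Measurable events and matrices *)

Section measurable_events.
Context d (T : measurableType d) (R : realType).

Lemma exists_bigsetU (I : finType) (A : I -> set T) :
  [set w | exists i, A i w] = \big[setU/set0]_(i <- enum I) A i.
Proof.
rewrite -bigcup_seq; apply/seteqP; split=> w /= [i].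
  by move=> Aiw; exists i => //=; rewrite mem_enum.
by move=> _ Aiw; exists i.
Qed.

Lemma measurable_exists (I : finType) (A : I -> set T) :
  (forall i, measurable (A i)) -> measurable [set w | exists i, A i w].
Proof. by move=> mA; rewrite exists_bigsetU; exact: bigsetU_measurable. Qed.

Lemma measurable_gt_norm (f : T -> R) (c : R) : measurable_fun setT f ->
  measurable [set w | c < `|f w|].
Proof.
move=> mf; rewrite (_ : [set _ | _] = (fun w => `|f w|) @^-1` `]c, +oo[).
  by rewrite -[X in measurable X]setTI; apply: measurableT_comp.
by apply/seteqP; split=> w /=; rewrite in_itv/= andbT.
Qed.

End measurable_events.

Section measurable_matrices.
Context d (T : measurableType d) (R : realType).

(** Off the closed set where the value is 0 the inverse is continuous. *)
Lemma measurable_funV (f : T -> R) : measurable_fun setT f ->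
  measurable_fun setT (fun w => (f w)^-1).
Proof.
move=> mf; apply: (measurableT_comp (f := @GRing.inv R)) => //.
rewrite -(setUv [set 0 : R]); apply/measurable_funU => //.
  exact: measurableC.
split; first exact: measurable_fun_set1.
apply: open_continuous_measurable_fun.
  by rewrite openC; exact: closed_eq.
by move=> y; rewrite inE/= => /eqP y0; exact: inv_continuous.
Qed.

Definition measurable_mx m n (A : T -> 'M[R]_(m, n)) : Prop :=
  forall i j, measurable_fun setT (fun w => A w i j).

Lemma measurable_mx_mul m n q (A : T -> 'M[R]_(m, n)) (B : T -> 'M[R]_(n, q)) :
  measurable_mx A -> measurable_mx B -> measurable_mx (fun w => A w *m B w).
Proof.
move=> mA mB i j; under eq_fun do rewrite mxE.
by apply: measurable_sum => k; exact: measurable_funM.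
Qed.

Lemma measurable_mx_scale m n (c : T -> R) (A : T -> 'M[R]_(m, n)) :
  measurable_fun setT c -> measurable_mx A -> measurable_mx (fun w => c w *: A w).
Proof. by move=> mc mA i j; under eq_fun do rewrite mxE; exact: measurable_funM. Qed.

Lemma measurable_mx_sub m n (A B : T -> 'M[R]_(m, n)) :
  measurable_mx A -> measurable_mx B -> measurable_mx (fun w => A w - B w).
Proof. by move=> mA mB i j; under eq_fun do rewrite !mxE; exact: measurable_funB. Qed.

Lemma measurable_mx_tr m n (A : T -> 'M[R]_(m, n)) :
  measurable_mx A -> measurable_mx (fun w => (A w)^T).
Proof. by move=> mA i j; under eq_fun do rewrite mxE; exact: mA. Qed.

Lemma measurable_det n (A : T -> 'M[R]_n) :
  measurable_mx A -> measurable_fun setT (fun w => \det (A w)).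
Proof.
move=> mA; apply: measurable_sum => s; apply: measurable_funM => //.
by apply: measurable_prod => i _; exact: mA.
Qed.

Lemma measurable_mx_adj n (A : T -> 'M[R]_n) :
  measurable_mx A -> measurable_mx (fun w => \adj (A w)).
Proof.
move=> mA i j; under eq_fun do rewrite mxE; apply: measurable_funM => //.
apply: measurable_det => k l; under eq_fun do rewrite !mxE; exact: mA.
Qed.

End measurable_matrices.

Section coordinates.
Context d (T : measurableType d) (R : realType).
Variables (m n : nat) (Z : T -> 'M[R]_(m, n)).

(** The generators of [sigma_generated Z]: the tail bounds below work on the
    type T equipped with the sigma-algebra that they generate. *)
Definition entry_events : set (set T) :=
  [set A | exists i j (B : set R),
     measurable B /\ A = (fun w => Z w i j) @^-1` B].

Lemma entry_events_measurable :
  (forall i j, measurable_fun setT (fun w => Z w i j)) ->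
  entry_events `<=` measurable.
Proof.
move=> mZ _ [i [j [B [mB ->]]]].
by rewrite -[X in measurable X]setTI; exact: mZ.
Qed.

Lemma entry_measurable_generated i j :
  measurable_fun setT ((fun w => Z w i j) : g_sigma_algebraType entry_events -> R).
Proof.
move=> _ B mB; rewrite setTI; apply: sub_sigma_algebra.
by exists i, j, B.
Qed.

End coordinates.

(** * Independence and integration *)

Section conditioning.
Local Open Scope ereal_scope.
Context d (T : measurableType d) (R : realType) (P : probability T R).
Variables (F G : set (set T)).
Hypotheses (mF : F `<=` measurable) (mG : G `<=` measurable)
  (indep : independent2 P <<s F >> <<s G >>).

Let T1 := g_sigma_algebraType F.
Let T2 := g_sigma_algebraType G.

Lemma measurable_generated (H : set (set T)) : H `<=` measurable ->
  <<s H >> `<=` measurable.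
Proof. by move=> mH; apply: smallest_sub => //; exact: sigma_algebra_measurable. Qed.

Let id1 : T -> T1 := fun w => w.
Let id2 : T -> T2 := fun w => w.

Let mid1 : measurable_fun setT id1.
Proof. by move=> _ A mA; rewrite setTI; exact: measurable_generated mA. Qed.

Let mid2 : measurable_fun setT id2.
Proof. by move=> _ A mA; rewrite setTI; exact: measurable_generated mA. Qed.

HB.instance Definition _ := @isMeasurableFun.Build _ _ T T1 id1 mid1.
HB.instance Definition _ := @isMeasurableFun.Build _ _ T T2 id2 mid2.

Let P1 : probability T1 R := distribution P id1.
Let P2 : probability T2 R := distribution P id2.
Let diag : T -> T1 * T2 := fun w => (w, w).

Let mdiag : measurable_fun setT diag.
Proof. exact: measurable_fun_pair. Qed.

HB.instance Definition _ := @isMeasurableFun.Build _ _ T (T1 * T2)%type diag mdiag.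

(** The diagonal map sends P to the product of its restrictions to the two
    sigma-algebras, because independence is exactly the product formula on
    rectangles.  Tonelli then turns a bound that is uniform in the first
    argument into a bound for P, which plays the role of conditioning. *)
Lemma independent_section_bound (A : set (T1 * T2)) (E : set T1) (c : \bar R) :
  measurable A -> measurable E -> 0 <= c ->
  (forall x, E x -> P [set y | A (x, y)] <= c) ->
  P [set w | E w /\ A (w, w)] <= c.
Proof.
move=> mA mE c0 AE.
pose A' := A `&` (E `*` setT).
have mA' : measurable A' by apply: measurableI => //; exact: measurableX.
have -> : [set w | E w /\ A (w, w)] = diag @^-1` A'.
  by apply/seteqP; split=> w /=; rewrite /A'/=; tauto.
have indepX (B1 : set T1) (B2 : set T2) : measurable B1 -> measurable B2 ->
    distribution P diag (B1 `*` B2) = P1 B1 * P2 B2.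
  by move=> mB1 mB2; rewrite -[RHS](indep mB1 mB2).
rewrite -[X in X <= _](product_measure_unique indepX mA').
have mc : measurable_fun [set: T1] (cst c) by [].
apply: (@le_trans _ _ (\int[P1]_x cst c x)); last first.
  rewrite integral_cst// [X in c * X]probability_setT mule1//.
apply: ge0_le_integral => //.
  exact: measurable_fun_xsection.
move=> x _ /=; have [Ex|nEx] := pselect (E x).
  apply: le_trans (AE _ Ex).
  rewrite le_eqVlt; apply/orP; left; apply/eqP; congr (P _).
  by apply/seteqP; split=> y; rewrite /id2 /xsection /A' /= inE//= => -[].
rewrite (_ : xsection A' x = set0) ?measure0//.
by apply/seteqP; split=> y //; rewrite /xsection /A'/= inE /= => -[_ []].
Qed.
End conditioning.

Import HBNNSimple.

Section density.
Local Open Scope ereal_scope.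
Context d d' (T : measurableType d) (T' : measurableType d') (R : realType).
Variables (mu : {measure set T -> \bar R}) (nu : {measure set T' -> \bar R}).
Variables (phi : T -> T') (G : T -> R) (c : R).
Hypotheses (mphi : measurable_fun setT phi) (mG : measurable_fun setT G)
  (G0 : forall x, (0 <= G x)%R)
  (density : forall A, measurable A ->
    \int[mu]_(x in phi @^-1` A) (G x)%:E = c%:E * nu A).

Let density_nnsfun (h : {nnsfun T' >-> R}) :
  \int[mu]_x ((h (phi x) * G x)%R)%:E = c%:E * \int[nu]_y (h y)%:E.
Proof.
have mpre A : measurable A -> measurable (phi @^-1` A).
  by move=> mA; rewrite -[X in measurable X]setTI; exact: mphi.
have mGE D : measurable_fun D (fun x => (G x)%:E).
  exact/measurable_EFinP/measurable_funTS.
transitivity (\int[mu]_x \sum_(k \in range h)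
    (k * (\1_(phi @^-1` (h @^-1` [set k])) x * G x))%:E).
  apply: eq_integral => x _; rewrite fimfunE mulr_fsuml -fsumEFin//.
  by apply: eq_fsbigr => k _; rewrite mulrA.
rewrite ge0_integral_fsum//; last 2 first.
- move=> k; apply/measurable_EFinP; apply: measurable_funM => //.
  apply: measurable_funM => //; apply: measurable_indic; exact: mpre.
- move=> k x _; rewrite lee_fin mulrA mulr_ge0//.
  have := nnfun_muleindic_ge0 h k (phi x); rewrite lee_fin; exact.
rewrite integralT_nnsfun sintegralE ge0_mule_fsumr//; last first.
  by move=> k; rewrite nnsfun_mulemu_ge0.
apply: eq_fsbigr => k /[!inE] -[y _ <-{k}].
under eq_integral do rewrite EFinM.
rewrite ge0_integralZl//; last 3 first.
- apply/measurable_EFinP/measurable_funM => //.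
  by apply: measurable_indic; exact: mpre.
- by move=> x _; rewrite lee_fin mulr_ge0.
- by rewrite lee_fin.
rewrite muleCA; congr (_ * _).
rewrite -density// [RHS]integral_mkcond; apply: eq_integral => x _.
by rewrite patchE indicE; case: ifPn; rewrite ?mul1r ?mul0r.
Qed.

(** It suffices to know G as a density on sets: simple functions follow by
    linearity and nonnegative functions by monotone convergence.  This single
    statement covers the change of variables for a normal law (mu is Lebesgue
    measure and G its density) and the independence of one factor from a
    product of others (nu is a restriction of mu and G the product). *)
Lemma ge0_integral_density (f : T' -> \bar R) :
  measurable_fun setT f -> (forall y, 0 <= f y) ->
  \int[mu]_x (f (phi x) * (G x)%:E) = c%:E * \int[nu]_y f y.
Proof.
move=> mf f0; pose h := nnsfun_approx measurableT mf.
have hcvg y : (EFin \o h n) y @[n --> \oo] --> f y by exact: cvg_nnsfun_approx.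
transitivity (limn (fun n => \int[mu]_x ((h n (phi x) * G x)%R)%:E)).
  rewrite -monotone_convergence//.
  - apply: eq_integral => x _; apply/esym/cvg_lim => //.
    under eq_cvg do rewrite EFinM.
    by apply: cvgeZr => //; exact: (hcvg (phi x)).
  - move=> n; apply/measurable_EFinP/measurable_funM => //.
    exact: measurableT_comp.
  - by move=> n x _; rewrite lee_fin mulr_ge0.
  - move=> x _ a b ab; rewrite lee_fin ler_wpM2r//.
    exact/lefP/nd_nnsfun_approx.
under eq_fun do rewrite density_nnsfun.
apply/cvg_lim => //; apply: cvgeZl => //.
have -> : \int[nu]_y f y = \int[nu]_y limn (fun n => (h n y)%:E).
  by apply: eq_integral => y _; apply/esym/cvg_lim => //; exact: hcvg.
apply: cvg_monotone_convergence => //.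
- by move=> n; exact/measurable_EFinP.
- by move=> n x _; rewrite lee_fin.
- by move=> x _ a b ab; rewrite lee_fin; exact/lefP/nd_nnsfun_approx.
Qed.

End density.

Section independence.
Local Open Scope ereal_scope.
Context d (T : measurableType d) (R : realType) (P : probability T R).
Variables (I : finType) (F : I -> set (set T)).
Hypotheses (mF : forall i, F i `<=` measurable)
  (indep : mutually_independent P (fun i => <<s F i>>)).

Let Ti i := g_sigma_algebraType (F i).

Let idi i : T -> Ti i := fun w => w.

Let midi i : measurable_fun setT (idi i).
Proof. by move=> _ A mA; rewrite setTI; exact: measurable_generated mA. Qed.

HB.instance Definition _ i := @isMeasurableFun.Build _ _ T (Ti i) (idi i) (@midi i).

Variables (f : I -> T -> R) (m : I -> R).
Hypotheses (mf : forall i, measurable_fun setT (f i : Ti i -> R))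
  (f0 : forall i w, (0 <= f i w)%R)
  (fm : forall i, \int[P]_w (f i w)%:E = (m i)%:E).

Let mfT i : measurable_fun setT (f i).
Proof. exact: (measurableT_comp (@mf i) (@midi i)). Qed.

Let mbigcap (J : {set I}) (A : I -> set T) :
  (forall i, <<s F i>> (A i)) -> measurable (\bigcap_(i in [set` J]) A i).
Proof.
move=> FA; apply: fin_bigcap_measurable => // i _.
by apply: (@measurable_generated _ _ (F i)).
Qed.

(* Mutual independence is the case in which all factors are indicators; they
   are replaced by the functions f one at a time, those already replaced
   forming the density in the next step. *)
Let indicator_prod (k : nat) (J : {set I}) (A : I -> set T) :
  #|J| = k -> (forall i, <<s F i>> (A i)) ->
  \int[P]_(w in \bigcap_(i in [set` (~: J)%SET]) A i) (\prod_(i in J) f i w)%:E =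
  (\prod_(i in J) m i)%:E * \prod_(i in (~: J)%SET) P (A i).
Proof.
elim: k J A => [|k IH] J A Jk FA.
  have -> : J = finset.set0 by apply/eqP; rewrite -cards_eq0 Jk.
  under eq_integral do rewrite big_set0.
  rewrite big_set0 mul1e -indep// integral_cst ?mul1e//.
  exact: mbigcap.
have [j jJ] : exists j, j \in J by apply/set0Pn; rewrite -card_gt0 Jk.
pose J' := (J :\ j)%SET.
have jJC : j \notin (~: J)%SET by rewrite finset.in_setC negbK.
have cJ' : #|J'| = k by move: Jk; rewrite (cardsD1 j J) jJ => -[].
have JC' : (~: J' = j |: ~: J)%SET.
  by apply/setP => i; rewrite !inE negb_and negbK.
pose D := \bigcap_(i in [set` (~: J)%SET]) A i.
have mD : measurable D by exact: mbigcap.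
pose G w := (\1_D w * \prod_(i in J') f i w)%R.
have mG : measurable_fun setT G.
  apply: measurable_funM; first exact: measurable_indic.
  under eq_fun do rewrite big_mkcond.
  by apply: measurable_prod => i _; case: (i \in J').
have G0 w : (0 <= G w)%R by rewrite mulr_ge0// prodr_ge0.
pose q := fine (\prod_(i in (~: J)%SET) P (A i)).
have qE : q%:E = \prod_(i in (~: J)%SET) P (A i).
  by rewrite fineK// -indep// fin_num_measure.
pose c := (\prod_(i in J') m i * q)%R.
have key (B : set (Ti j)) : measurable B ->
    \int[P]_(w in idi j @^-1` B) (G w)%:E = c%:E * distribution P (idi j) B.
  move=> mB; pose A' i := if i == j then B else A i.
  have FA' i : <<s F i>> (A' i).
    by rewrite /A'; case: eqP => [->//|_]; exact: FA.
  have A'j : A' j = B by rewrite /A' eqxx.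
  have A'E i : i \in (~: J)%SET -> A' i = A i.
    by rewrite /A'; case: eqP => // -> ; rewrite (negbTE jJC).
  have := IH J' A' cJ' FA'; rewrite JC' big_setU1//= A'j.
  rewrite (eq_bigr (P \o A)); last by move=> i iJ; rewrite /= A'E.
  rewrite -qE muleCA -EFinM -/c muleC => <-.
  rewrite integral_mkcond [RHS]integral_mkcond; apply: eq_integral => w _.
  rewrite !patchE /G indicE.
  have -> : (w \in \bigcap_(i in [set` (j |: ~: J)%SET]) A' i) =
      (w \in idi j @^-1` B) && (w \in D).
    apply/idP/andP => [|[]]; rewrite !inE /D /=.
      move=> H; split.
        by have := H j; rewrite /A' eqxx; apply; rewrite /= setU11.
      move=> i /= iJ; rewrite -(A'E i iJ); apply: H => /=.
      by rewrite inE iJ orbT.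
    move=> Bw H i /=; rewrite in_setU1 => /orP[/eqP->|iJ].
      by rewrite /A' eqxx.
    by rewrite A'E//; exact: H.
  case: (w \in idi j @^-1` B) => //=.
  by case: (w \in D); rewrite ?mul1r ?mul0r.
have mfj : measurable_fun setT (fun w : Ti j => (f j w)%:E).
  by apply/measurable_EFinP; exact: (@mf j).
have fj0 w : 0 <= (f j w)%:E by rewrite lee_fin.
have := ge0_integral_density (@midi j) mG G0 key mfj fj0.
have -> : \int[distribution P (idi j)]_y (f j y)%:E = (m j)%:E.
  by rewrite (ge0_integral_distribution (idi j : {RV P >-> Ti j}))// -fm.
rewrite -EFinM -qE -EFinM => H.
rewrite (big_setD1 j)//= -/J' [in RHS](mulrC (m j)) mulrAC -/c -H.
rewrite [LHS]integral_mkcond; apply: eq_integral => w _.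
rewrite patchE /G indicE (big_setD1 j)//= -/J' -EFinM /idi.
by case: (w \in D); rewrite ?mul1r ?mul0r// mulr0.
Qed.

Lemma expectation_prod : \int[P]_w (\prod_i f i w)%:E = (\prod_i m i)%:E.
Proof.
have bigT (g : I -> R) : (\prod_(i in [set: I]%SET) g i = \prod_i g i)%R.
  by apply: eq_bigl => i; rewrite finset.in_setT.
have := @indicator_prod _ [set: I]%SET (fun=> setT) erefl (fun i => @measurableT _ (Ti i)).
rewrite finset.setCT (_ : \bigcap_(i in _) _ = setT); last first.
  by apply/seteqP; split=> // w _ i _.
rewrite big_set0 mule1.
by rewrite bigT; under eq_integral do rewrite bigT.
Qed.
End independence.

(** * Moment generating functions and tails of normal variables *)

Section normal.
Local Open Scope ereal_scope.
Context d (T : measurableType d) (R : realType) (P : probability T R).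

(** The condition that [centered_gaussian] puts on each linear form. *)
Definition has_normal_law (v : R) (U : T -> R) : Prop :=
  measurable_fun [set: T] U /\
  forall B : set R, measurable B -> pushforward P U B = normal_law 0 v B.

Variables (v : R) (U : T -> R).
Hypotheses (v0 : (0 <= v)%R) (lawU : has_normal_law v U).

Let mU : measurable_fun setT U. Proof. by case: lawU. Qed.

HB.instance Definition _ := @isMeasurableFun.Build _ _ T R U mU.

Lemma integral_normal_law (g : R -> \bar R) : v != 0%R ->
  measurable_fun setT g -> (forall x, 0 <= g x) ->
  \int[P]_w g (U w) =
  \int[lebesgue_measure]_x (g x * (normal_pdf 0 (Num.sqrt v) x)%:E).
Proof.
move=> v_neq0 mg g0.
rewrite -(@ge0_integral_distribution _ _ _ _ _ P U)//.
have := @ge0_integral_density _ _ _ _ R lebesgue_measure (distribution P U)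
  id (normal_pdf 0 (Num.sqrt v)) 1 _ _ _ _ g mg g0.
rewrite mul1e => -> //.
- exact: measurable_normal_pdf.
- exact: normal_pdf_ge0.
- move=> A mA; rewrite mul1e [RHS](lawU.2 _ mA) /normal_law (negbTE v_neq0).
  by [].
Qed.

Lemma integral_normal_law0 (g : R -> \bar R) : v = 0%R ->
  measurable_fun setT g -> (forall x, 0 <= g x) ->
  \int[P]_w g (U w) = g 0%R.
Proof.
move=> v_eq0 mg g0.
rewrite -(@ge0_integral_distribution _ _ _ _ _ P U)//.
have := @ge0_integral_density _ _ _ _ R \d_(0%R : R) (distribution P U)
  id (cst 1%R) 1 _ _ _ _ g mg g0.
rewrite mul1e => <- //.
- by under eq_integral do rewrite mule1; rewrite integral_dirac// diracT mul1e.
- move=> A mA; rewrite mul1e [RHS](lawU.2 _ mA) /normal_law v_eq0 eqxx.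
  by rewrite -[RHS]mul1e -integral_cst.
Qed.

(** Multiplying the density by exp(theta x) shifts its mean by theta v, up to
    the constant factor that is the value of the integral. *)
Lemma mgf_normal_law (theta : R) :
  \int[P]_w (expR (theta * U w))%:E = (expR (theta ^+ 2 * v / 2))%:E.
Proof.
have mexp : measurable_fun setT (fun x : R => (expR (theta * x))%:E : \bar R).
  by apply/measurable_EFinP; apply: measurableT_comp => //; exact: measurable_funM.
have ge0exp x : 0 <= (expR (theta * x))%:E by rewrite lee_fin expR_ge0.
have [v_eq0|v_neq0] := eqVneq v 0%R.
  by rewrite (integral_normal_law0 v_eq0 mexp)// v_eq0 !mulr0 mul0r.
rewrite (integral_normal_law v_neq0 mexp)//.
have s0 : Num.sqrt v != 0%R by rewrite gt_eqF// sqrtr_gt0 lt_def v_neq0.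
transitivity (\int[lebesgue_measure]_x ((expR (theta ^+ 2 * v / 2))%:E *
    (normal_pdf (theta * v) (Num.sqrt v) x)%:E)).
  apply: eq_integral => x _; rewrite -!EFinM !normal_pdfE// /normal_fun.
  rewrite mulrCA [in RHS]mulrCA -!expRD sqr_sqrtr//.
  congr ((_ * expR _)%R%:E); field; exact: v_neq0.
rewrite ge0_integralZl//.
- by rewrite integral_normal_pdf mule1.
- by apply/measurable_EFinP; exact: measurable_normal_pdf.
- by move=> x _; rewrite lee_fin normal_pdf_ge0.
Qed.

(** Multiplying the density by exp(theta x^2) turns the variance v into
    v / (1 - 2 theta v), up to the ratio of the normalising constants. *)
Lemma mgf_sqr_normal_law (theta : R) : (2 * theta * v < 1)%R ->
  \int[P]_w (expR (theta * U w ^+ 2))%:E =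
  ((Num.sqrt (1 - 2 * theta * v))^-1)%:E.
Proof.
move=> tv.
have mexp : measurable_fun setT (fun x : R => (expR (theta * x ^+ 2))%:E : \bar R).
  apply/measurable_EFinP; apply: measurableT_comp => //; apply: measurable_funM => //.
have ge0exp x : 0 <= (expR (theta * x ^+ 2))%:E by rewrite lee_fin expR_ge0.
have [v_eq0|v_neq0] := eqVneq v 0%R.
  rewrite (integral_normal_law0 v_eq0 mexp)// v_eq0 !mulr0 expr0n/= mulr0 expR0.
  by rewrite subr0 sqrtr1 invr1.
rewrite (integral_normal_law v_neq0 mexp)//.
have c0 : (0 < 1 - 2 * theta * v)%R by rewrite subr_gt0.
set c := (1 - 2 * theta * v)%R in c0 *.
have vc0 : (0 < v / c)%R by rewrite divr_gt0// lt_def v_neq0.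
have s0 : Num.sqrt v != 0%R by rewrite gt_eqF// sqrtr_gt0 lt_def v_neq0.
have s1 : Num.sqrt (v / c) != 0%R by rewrite gt_eqF// sqrtr_gt0.
transitivity (\int[lebesgue_measure]_x (((Num.sqrt c)^-1)%:E *
    (normal_pdf 0 (Num.sqrt (v / c)) x)%:E)).
  apply: eq_integral => x _; rewrite -!EFinM !normal_pdfE// /normal_fun.
  rewrite mulrCA [in RHS]mulrA -!expRD !sqr_sqrtr//; last exact: ltW.
  congr ((_ * expR _)%R%:E).
    rewrite /normal_peak !sqr_sqrtr//; last exact: ltW.
    rewrite -invfM -sqrtrM; last exact: ltW.
    by congr ((Num.sqrt _)^-1)%R; field; exact: lt0r_neq0.
  rewrite /c; field; apply/andP; split; [exact: lt0r_neq0|exact: v_neq0].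
rewrite ge0_integralZl//.
- by rewrite integral_normal_pdf mule1.
- by apply/measurable_EFinP; exact: measurable_normal_pdf.
- by move=> x _; rewrite lee_fin normal_pdf_ge0.
Qed.

End normal.

Section tails.
Local Open Scope ereal_scope.
Context d (T : measurableType d) (R : realType) (P : probability T R).

Lemma markov_bound (A : set T) (f : T -> \bar R) (c : R) :
  measurable A -> measurable_fun setT f -> (forall w, 0 <= f w) -> (0 <= c)%R ->
  (forall w, A w -> c%:E <= f w) -> c%:E * P A <= \int[P]_w f w.
Proof.
move=> mA mf f0 c0 cf.
have mfA : measurable_fun A f by exact: measurable_funTS.
rewrite -integral_cst//.
apply: (@le_trans _ _ (\int[P]_(w in A) f w)); first exact: ge0_le_integral.
by apply: ge0_subset_integral.
Qed.

(** Chernoff's bound with the optimal exponent tau / V for the variance bound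
    V, applied to U and to - U. *)
Lemma normal_tail (v V tau : R) (U : T -> R) :
  (0 <= v)%R -> has_normal_law P v U -> (v <= V)%R -> (0 < V)%R -> (0 <= tau)%R ->
  P [set w | (tau < `|U w|)%R] <= (2 * expR (- (tau ^+ 2 / (2 * V))))%:E.
Proof.
move=> v0 lawU vV V0 tau0; have mU := lawU.1.
have mge (s : R) : measurable [set w | (tau <= s * U w)%R].
  rewrite (_ : [set _ | _] = (fun w => s * U w)%R @^-1` `[tau, +oo[).
    by rewrite -[X in measurable X]setTI; apply: measurable_funM.
  by apply/seteqP; split=> w /=; rewrite in_itv/= andbT.
have one_sided (s : R) : (s ^+ 2 = 1)%R ->
    P [set w | (tau <= s * U w)%R] <= (expR (- (tau ^+ 2 / (2 * V))))%:E.
  move=> s2; pose th := (tau / V)%R.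
  have th0 : (0 <= th)%R by rewrite divr_ge0// ltW.
  have := @markov_bound _ (fun w => (expR (th * s * U w))%:E) (expR (th * tau))
    (mge s) _ _ (expR_ge0 _) _.
  rewrite (mgf_normal_law v0 lawU) => H.
  rewrite -(@lee_pmul2l _ (expR (th * tau))%:E) ?lte_fin ?expR_gt0//.
  apply: le_trans (H _ _ _) _.
  - by apply/measurable_EFinP/measurableT_comp => //; exact: measurable_funM.
  - by move=> w; rewrite lee_fin expR_ge0.
  - by move=> w /= tw; rewrite lee_fin ler_expR -mulrA ler_wpM2l.
  - rewrite -EFinM lee_fin -expRD ler_expR exprMn s2 mulr1.
    rewrite (_ : (_ - _)%R = (th ^+ 2 * V / 2)%R); last first.
      by rewrite /th; field; exact: lt0r_neq0.
    by rewrite ler_pM2r// ler_wpM2l// exprn_ge0.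
have sub : [set w | (tau < `|U w|)%R] `<=`
    [set w | (tau <= 1 * U w)%R] `|` [set w | (tau <= -1 * U w)%R].
  by move=> w /=; rewrite ltr_normr mul1r mulN1r => /orP[/ltW|/ltW]; tauto.
have mabs := measurable_gt_norm tau mU.
apply: le_trans (le_measure _ _ _ sub) _; rewrite ?inE//.
  by apply: measurableU.
apply: le_trans (measureU2 _ _ _) _ => //.
by rewrite mulr_natl mulr2n EFinD leeD// one_sided// ?expr1n// sqrrN expr1n.
Qed.

End tails.

Section exp_bounds.
Context {R : realType}.
Implicit Types t x y : R.

Lemma binomial_lower_bound (k : nat) y : 0 <= y ->
  1 + k%:R * y + k%:R * (k%:R - 1) / 2 * y ^+ 2 <= (1 + y) ^+ k.
Proof.
move=> y0; elim: k => [|k IH]; first by rewrite expr0; lra.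
rewrite [leRHS]exprSr.
have y1 : 0 <= 1 + y by lra.
apply: le_trans (ler_wpM2r y1 IH).
have k0 : 0 <= k%:R * (k%:R - 1) :> R.
  by case: k {IH} => [|k]; [rewrite mul0r|rewrite mulr_ge0// subr_ge0 ler1n].
have y3 : 0 <= y ^+ 3 by apply: exprn_ge0.
have := mulr_ge0 k0 y3; rewrite -natr1; nra.
Qed.

(** The coefficient 31/64 comes from exp x = (exp (x / 32))^32 and
    exp y >= 1 + y; any value above 12/25 is enough for the next lemma. *)
Lemma expR_lower_quadratic x : 0 <= x -> 1 + x + 31 / 64 * x ^+ 2 <= expR x.
Proof.
move=> x0; have -> : expR x = expR (x / 32) ^+ 32.
  by rewrite -expRM_natl; congr expR; field.
have x32 : 0 <= x / 32 by rewrite divr_ge0.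
apply: le_trans (lerXn2r _ _ _ (expR_ge1Dx (x / 32)));
  rewrite ?nnegrE ?expR_ge0//; last lra.
by apply: le_trans (binomial_lower_bound 32 x32); lra.
Qed.

Let add1_le_expR_pos t : 0 <= t <= 1 / 2 -> 1 + t <= expR (t - t ^+ 2 / 3).
Proof.
move=> /andP[t0 t1].
have x0 : 0 <= t - t ^+ 2 / 3 by nra.
apply: le_trans (expR_lower_quadratic x0).
have -> : 1 + (t - t ^+ 2 / 3) + 31 / 64 * (t - t ^+ 2 / 3) ^+ 2 =
  1 + t + t ^+ 2 * (31 / 64 * (1 - t / 3) ^+ 2 - 1 / 3) by field.
have : 0 <= 31 / 64 * (1 - t / 3) ^+ 2 - 1 / 3 by nra.
have := sqr_ge0 t; nra.
Qed.

(* Split the exponent as - t^2 - x with x = t - 2 t^2 / 3: then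
   1 - t^2 <= exp (- t^2), and (1 + t) exp (- x) >= 1 by a polynomial
   inequality. *)
Let sub1_le_expR t : 0 <= t <= 1 / 2 -> 1 - t <= expR (- t - t ^+ 2 / 3).
Proof.
move=> /andP[t0 t1].
pose x := t - 2 / 3 * t ^+ 2.
have x0 : 0 <= x by rewrite /x; nra.
have x1 : x <= t by rewrite /x; nra.
have lower : (1 - x / 4) ^+ 4 <= expR (- x).
  have -> : expR (- x) = expR (- (x / 4)) ^+ 4.
    by rewrite -expRM_natl; congr expR; field.
  apply: lerXn2r; rewrite ?nnegrE ?expR_ge0//; first lra.
  exact: expR_ge1Dx.
have poly : 1 <= (1 + t) * (1 - x / 4) ^+ 4.
  have -> : (1 - x / 4) ^+ 4 =
    1 - x + 3 / 8 * x ^+ 2 - x ^+ 3 / 16 + x ^+ 4 / 256 by field.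
  have x3 : x <= 1 / 3 by rewrite /x; nra.
  have u0 : 1 - 7 / 9 * t <= (1 + t) * (1 - 2 / 3 * t) ^+ 2.
    have : 0 <= t * t * t by rewrite !mulr_ge0.
    by nra.
  have c0 : 17 / 48 <= 3 / 8 - x / 16 by lra.
  have prod : 17 / 48 * (1 - 7 / 9 * t) <=
      (3 / 8 - x / 16) * ((1 + t) * (1 - 2 / 3 * t) ^+ 2).
    by apply: ler_pM => //; lra.
  have x4 : 0 <= (1 + t) * (x ^+ 4 / 256).
    by rewrite mulr_ge0 ?divr_ge0 ?exprn_ge0//; lra.
  have sqt : 0 <= t ^+ 2 *
      ((3 / 8 - x / 16) * ((1 + t) * (1 - 2 / 3 * t) ^+ 2) + 2 / 3 * t - 1 / 3).
    by rewrite mulr_ge0 ?sqr_ge0//; lra.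
  rewrite -subr_ge0 [leRHS](_ : _ = t ^+ 2 *
      ((3 / 8 - x / 16) * ((1 + t) * (1 - 2 / 3 * t) ^+ 2) + 2 / 3 * t - 1 / 3)
      + (1 + t) * (x ^+ 4 / 256)); first exact: addr_ge0.
  by rewrite /x; field.
have -> : - t - t ^+ 2 / 3 = - (t ^+ 2) - x by rewrite /x; field.
rewrite expRD.
have sq : 1 - t ^+ 2 <= expR (- t ^+ 2) by exact: expR_ge1Dx.
have t1' : 0 < 1 + t by lra.
rewrite -(ler_pM2l t1'); apply: le_trans (_ : 1 - t ^+ 2 <= _); first nra.
apply: le_trans sq _.
rewrite mulrCA ler_peMr ?expR_ge0//; apply: le_trans poly _.
by rewrite ler_pM2l.
Qed.

(** This is the rate function of the chi-square law: it yields the bound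
    (1 + t) exp (- t) <= exp (- t^2 / 3) of both tails at once, the sign of t
    telling which one. *)
Lemma add1_le_expR t : `|t| <= 1 / 2 -> 1 + t <= expR (t - t ^+ 2 / 3).
Proof.
move=> tb; have [t0|t0] := leP 0 t.
  by apply: add1_le_expR_pos; rewrite t0 -(ger0_norm t0).
have := @sub1_le_expR (- t); rewrite opprK sqrrN; apply.
by rewrite oppr_ge0 (ltW t0) -ltr0_norm.
Qed.

End exp_bounds.

Section unions.
Local Open Scope ereal_scope.
Context d (T : measurableType d) (R : realType) (P : probability T R).

Lemma union_bound (I : finType) (A : I -> set T) (c : R) :
  (forall i, measurable (A i)) -> (forall i, P (A i) <= c%:E) ->
  P [set w | exists i, A i w] <= (#|I|%:R * c)%:E.
Proof.
move=> mA Ac.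
suff H (r : seq I) : measurable (\big[setU/set0]_(i <- r) A i) /\
    P (\big[setU/set0]_(i <- r) A i) <= ((size r)%:R * c)%:E.
  by rewrite exists_bigsetU cardE; exact: (H (enum I)).2.
elim: r => [|i r [mr IH]].
  by rewrite big_nil measure0 mul0r; split.
rewrite big_cons; split; first exact: measurableU.
apply: le_trans (measureU2 _ _ _) _ => //.
by rewrite /= -natr1 mulrDl mul1r addrC EFinD leeD.
Qed.

End unions.

Section chi_square.
Local Open Scope ereal_scope.
Context d (T : measurableType d) (R : realType) (P : probability T R).
Variables (I : finType) (v : R) (U : I -> T -> R).
Hypotheses (v0 : (0 <= v)%R) (lawU : forall i, has_normal_law P v (U i))
  (mgfU : forall theta : R, (2 * theta * v < 1)%R ->
    \int[P]_w (expR (theta * \sum_i U i w ^+ 2))%:E =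
    ((Num.sqrt (1 - 2 * theta * v))^-1 ^+ #|I|)%:E).

Let S w : R := (\sum_i U i w ^+ 2)%R.
Let n : R := #|I|%:R.

Let mS : measurable_fun setT S.
Proof. by apply: measurable_sum => i; apply: measurable_funX; exact: (lawU i).1. Qed.

Let mgt (s b : R) : measurable [set w | (b < s * S w)%R].
Proof.
rewrite (_ : [set _ | _] = (fun w => s * S w)%R @^-1` `]b, +oo[).
  by rewrite -[X in measurable X]setTI; apply: measurable_funM.
by apply/seteqP; split=> w /=; rewrite in_itv/= andbT.
Qed.

(** A positive t gives the upper tail and a negative t the lower one.  The
    exponent th minimises the Chernoff bound; it satisfies
    1 - 2 th v = 1 / (1 + t). *)
Lemma chi_square_one_sided (t : R) : (0 < v)%R -> (`|t| <= 1 / 2)%R ->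
  P [set w | (t * (n * v * (1 + t)) < t * S w)%R] <=
  (expR (- (n * t ^+ 2 / 6)))%:E.
Proof.
move=> vpos tb; have t1' : (0 < 1 + t)%R by move: tb; rewrite ler_norml; lra.
pose th := (t / (2 * v * (1 + t)))%R.
have thv : (1 - 2 * th * v = (1 + t)^-1)%R.
  by rewrite /th; field; rewrite !lt0r_neq0.
have th1 : (2 * th * v < 1)%R by rewrite -subr_gt0 thv invr_gt0.
have := @markov_bound _ _ _ P _ (fun w => (expR (th * S w))%:E) (expR (n * t / 2))
  (mgt t (t * (n * v * (1 + t)))) _ _ (expR_ge0 _) _.
rewrite (mgfU th1) => H.
rewrite -(@lee_pmul2l _ (expR (n * t / 2))%:E) ?lte_fin ?expR_gt0//.
apply: le_trans (H _ _ _) _.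
- by apply/measurable_EFinP/measurableT_comp => //; exact: measurable_funM.
- by move=> w; rewrite lee_fin expR_ge0.
- move=> w /= tw; rewrite lee_fin ler_expR.
  have -> : (n * t / 2 = t * (n * v * (1 + t)) / (2 * v * (1 + t)))%R.
    by field; rewrite !lt0r_neq0.
  by rewrite /th [leRHS]mulrAC ler_pM2r ?invr_gt0 ?mulr_gt0// ltW.
- rewrite -EFinM lee_fin -expRD thv sqrtrV ?(ltW t1')// invrK.
  rewrite (_ : (n * t / 2 - n * t ^+ 2 / 6)%R = (n * ((t - t ^+ 2 / 3) / 2))%R);
    last by field.
  rewrite expRM_natl; apply: lerXn2r; rewrite ?nnegrE ?expR_ge0 ?sqrtr_ge0//.
  rewrite -(ler_pXn2r (n := 2)) ?nnegrE ?expR_ge0 ?sqrtr_ge0// sqr_sqrtr ?(ltW t1')//.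
  rewrite -expRM_natl (_ : (2 * _)%R = (t - t ^+ 2 / 3)%R); last by field.
  exact: add1_le_expR.
Qed.

(* For v = 0 the law is a Dirac mass, and the Chernoff exponent is undefined. *)
Let degenerate : v = 0%R -> P [set w | (0 < S w)%R] = 0.
Proof.
move=> v_eq0; have mU i : measurable [set w | U i w != 0%R].
  rewrite (_ : [set _ | _] = U i @^-1` (~` [set 0%R])).
    by rewrite -[X in measurable X]setTI; apply: (lawU i).1 => //; exact: measurableC.
  by apply/seteqP; split=> w /= /eqP.
have U0 i : P [set w | U i w != 0%R] <= 0%:E.
  rewrite (_ : [set _ | _] = U i @^-1` (~` [set 0%R])); last first.
    by apply/seteqP; split=> w /= /eqP.
  have := (lawU i).2 (~` [set 0%R]) (measurableC (measurable_set1 _)).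
  rewrite /pushforward /normal_law v_eq0 eqxx diracE => ->.
  by rewrite memNset//= => /(_ erefl).
apply/eqP; rewrite eq_le measure_ge0 andbT.
have := union_bound mU U0; rewrite mulr0; apply: le_trans.
apply: le_measure; rewrite ?inE.
- by have := mgt 1 0; under eq_set do rewrite mul1r.
- exact: measurable_exists.
- move=> w /= Sw; apply: contrapT => /forallNP H; move: Sw.
  by rewrite /S big1 ?ltxx// => i _; have /negP/negPn/eqP-> := H i; rewrite expr0n.
Qed.

Lemma chi_square_tail (t : R) : (0 <= t <= 1 / 2)%R ->
  P [set w | (n * v * t < `|S w - n * v|)%R] <= (2 * expR (- (n * t ^+ 2 / 6)))%:E.
Proof.
move=> /andP[t0 t1].
have mabs : measurable [set w | (n * v * t < `|S w - n * v|)%R].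
  by apply: measurable_gt_norm; exact: measurable_funB.
have [v_eq0|v_neq0] := eqVneq v 0%R.
  rewrite (_ : [set _ | _] = [set w | (0 < S w)%R]).
    by rewrite degenerate// lee_fin mulr_ge0 ?expR_ge0.
  apply/seteqP; split=> w /=; rewrite v_eq0 !mulr0 mul0r subr0 normr_gt0;
    by rewrite lt_def sumr_ge0 ?andbT// => i _; exact: sqr_ge0.
have vpos : (0 < v)%R by rewrite lt_def v_neq0.
have [t_eq0|t_neq0] := eqVneq t 0%R.
  apply: (@le_trans _ _ 1); first exact: probability_le1.
  by rewrite lee_fin t_eq0 expr0n/= mulr0 mul0r oppr0 expR0 mulr1 ler1n.
have tpos : (0 < t)%R by rewrite lt_def t_neq0.
have sub : [set w | (n * v * t < `|S w - n * v|)%R] `<=`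
    [set w | (t * (n * v * (1 + t)) < t * S w)%R] `|`
    [set w | (- t * (n * v * (1 + - t)) < - t * S w)%R].
  move=> w /=; rewrite ltr_normr => /orP[H|H]; [left|right].
    by rewrite ltr_pM2l//; lra.
  by rewrite !mulNr ltrN2 ltr_pM2l//; lra.
apply: le_trans (le_measure _ _ _ sub) _; rewrite ?inE//.
  by apply: measurableU; exact: mgt.
apply: le_trans (measureU2 _ _ _) _; [exact: mgt|exact: mgt|].
rewrite (_ : (2 * expR _)%R = (expR (- (n * t ^+ 2 / 6)) +
  expR (- (n * t ^+ 2 / 6)))%R); last by ring.
rewrite EFinD; apply: leeD.
- by rewrite chi_square_one_sided// ger0_norm.
- by rewrite -(sqrrN t) chi_square_one_sided// normrN ger0_norm.
Qed.

End chi_square.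

(** * The Gaussian design and the noise *)

Lemma linear_form_sum (R : realType) p (a z : 'cV[R]_p) :
  (a^T *m z) 0 0 = \sum_j a j 0 * z j 0.
Proof. by rewrite mxE; apply: eq_bigr => j _; rewrite mxE. Qed.

Section gaussian_rows.
Context d (T : measurableType d) (R : realType) (P : probability T R).
Variables (n p : nat) (Sigma : 'M[R]_p) (X : T -> 'M[R]_(n, p)).
Hypothesis rowsX : iid_gaussian_rows P Sigma X.

Let proj (a : 'cV[R]_p) (i : 'I_n) (w : T) : R := (a^T *m (row i (X w))^T) 0 0.

Let projE a i w : proj a i w = (\sum_j a j 0 * X w i j)%R.
Proof. by rewrite /proj linear_form_sum; apply: eq_bigr => j _; rewrite !mxE. Qed.

Lemma gaussian_design_entry_measurable i j : measurable_fun setT (fun w => X w i j).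
Proof.
have [_ /(_ (delta_mx j 0))[+ _]] := rowsX.1 i; congr measurable_fun.
apply/funext => w; rewrite -/(proj _ _ _) projE (bigD1 j)//= big1 ?addr0.
  by rewrite mxE !eqxx mul1r.
by move=> k kj; rewrite mxE (negbTE kj) mul0r.
Qed.

(** The projections of the rows on a fixed direction are independent normal
    variables with the same variance, whence a chi-square bound. *)
Lemma gaussian_projection_tail (a : 'cV[R]_p) (t : R) : (0 < n)%N ->
  (0 <= t <= 1 / 2)%R ->
  (P [set w | (n%:R * quadform Sigma a * t <
     `|\sum_i (\sum_j a j 0 * X w i j) ^+ 2 - n%:R * quadform Sigma a|)%R]
  <= (2 * expR (- (n%:R * t ^+ 2 / 6)))%:E)%E.
Proof.
move=> n_gt0 tb; have n0 : 'I_n by exact: Ordinal n_gt0.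
have v0 : (0 <= quadform Sigma a)%R by have [[_]] := rowsX.1 n0; exact.
have law i : has_normal_law P (quadform Sigma a) (proj a i).
  by have [_ /(_ a)] := rowsX.1 i.
pose F i := entry_events (fun w => row i (X w)).
have mF i : F i `<=` measurable.
  apply: entry_events_measurable => i' j.
  by under eq_fun do rewrite mxE; exact: gaussian_design_entry_measurable.
have := chi_square_tail v0 law _ tb; rewrite card_ord.
under eq_set do under eq_bigr do rewrite projE.
apply => theta th.
have := @expectation_prod _ _ _ P _ F mF rowsX.2
  (fun i w => expR (theta * proj a i w ^+ 2))
  (fun=> (Num.sqrt (1 - 2 * theta * quadform Sigma a))^-1%R) _ _ _.
under eq_integral do rewrite -expR_sum -mulr_sumr.
rewrite prodr_const card_ord; apply.
- move=> i; apply: measurableT_comp => //; apply: measurable_funM => //.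
  apply: measurable_funX.
  rewrite (_ : proj a i = (fun w => \sum_j a j 0 * row i (X w) 0 j)%R); last first.
    by apply/funext => w; rewrite projE; apply: eq_bigr => j _; rewrite mxE.
  apply: measurable_sum => j; apply: measurable_funM => //.
  exact: entry_measurable_generated.
- by move=> i w; exact: expR_ge0.
- by move=> i; exact: (mgf_sqr_normal_law v0 (law i)).
Qed.

End gaussian_rows.

Lemma bilinear_delta (R : realType) p (A : 'M[R]_p) j k :
  ((delta_mx j 0 : 'cV[R]_p)^T *m A *m (delta_mx k 0 : 'cV[R]_p)) 0 0 = A j k.
Proof. by rewrite trmx_delta -rowE -colE !mxE. Qed.

Lemma quadform_delta2 (R : realType) p (A : 'M[R]_p) j k (c : R) : A^T = A ->
  quadform A (delta_mx j 0 + c *: delta_mx k 0) =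
  A j j + 2 * c * A j k + c ^+ 2 * A k k.
Proof.
move=> Asym; rewrite /quadform.
have -> (x y : 'cV[R]_p) : (x + c *: y)^T = x^T + c *: y^T.
  by apply/matrixP => a b; rewrite !mxE.
rewrite !mulmxDl !mulmxDr.
rewrite -!scalemxAl -!scalemxAr !mxE.
have Akj : A k j = A j k by rewrite -{1}Asym mxE.
have := bilinear_delta A j j; have := bilinear_delta A j k.
have := bilinear_delta A k j; have := bilinear_delta A k k.
rewrite !mxE => -> -> -> ->; rewrite Akj; ring.
Qed.

Lemma trmx_mul_entry (R : realType) n p (X : 'M[R]_(n, p)) j k :
  (X^T *m X) j k = \sum_i X i j * X i k.
Proof. by rewrite mxE; apply: eq_bigr => i _; rewrite mxE. Qed.

Section gram_tail.
Context d (T : measurableType d) (R : realType) (P : probability T R).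
Variables (n p : nat) (Sigma : 'M[R]_p) (X : T -> 'M[R]_(n, p)).
Hypotheses (rowsX : iid_gaussian_rows P Sigma X)
  (Sigma1 : forall j, Sigma j j = 1) (n_gt0 : (0 < n)%N).

Lemma gram_entry_measurable j k : measurable_fun setT
  (fun w => ((X w)^T *m X w) j k - n%:R * Sigma j k).
Proof.
apply: measurable_funB => //; under eq_fun do rewrite trmx_mul_entry.
by apply: measurable_sum => i; apply: measurable_funM;
  exact: (gaussian_design_entry_measurable rowsX).
Qed.

(** By polarization the deviation of an entry is a quarter of the difference of
    two chi-square deviations, those of X_j + X_k and X_j - X_k, whose
    variances add up to 4; so t is also the deviation of the entry. *)
Lemma gram_entry_tail j k (t : R) : 0 <= t <= 1 / 2 ->
  (P [set w | (n%:R * t < `|((X w)^T *m X w) j k - n%:R * Sigma j k|)%R] <=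
  (4 * expR (- (n%:R * t ^+ 2 / 6)))%:E)%E.
Proof.
move=> tb.
have Ssym : Sigma^T = Sigma by have [[+ _] _] := rowsX.1 (Ordinal n_gt0).
pose U c w := \sum_i (X w i j + c * X w i k) ^+ 2.
pose v c := 1 + 2 * c * Sigma j k + c ^+ 2.
have mU c : measurable_fun setT (U c).
  apply: measurable_sum => i; apply: measurable_funX; apply: measurable_funD.
    exact: (gaussian_design_entry_measurable rowsX).
  by apply: measurable_funM => //; exact: (gaussian_design_entry_measurable rowsX).
pose bad c := [set w | n%:R * v c * t < `|U c w - n%:R * v c|].
have mbad c : measurable (bad c).
  by apply: measurable_gt_norm; exact: measurable_funB.
have Pbad c : (P (bad c) <= (2 * expR (- (n%:R * t ^+ 2 / 6)))%:E)%E.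
  have := gaussian_projection_tail rowsX (delta_mx j 0 + c *: delta_mx k 0) n_gt0 tb.
  rewrite quadform_delta2// !Sigma1 mulr1.
  have UE w : \sum_i (\sum_l (delta_mx j 0 + c *: delta_mx k 0 : 'cV[R]_p) l 0 *
      X w i l) ^+ 2 = U c w.
    apply: eq_bigr => i _; congr (_ ^+ 2).
    under eq_bigr do rewrite !mxE eqxx !andbT mulrDl.
    rewrite big_split/= (bigD1 j)//= eqxx mul1r big1 ?addr0; last first.
      by move=> l lj; rewrite (negbTE lj) mul0r.
    rewrite (bigD1 k)//= eqxx mulr1 big1 ?addr0// => l lk.
    by rewrite (negbTE lk) mulr0 mul0r.
  by under eq_set do rewrite UE.
have sub : [set w | n%:R * t < `|((X w)^T *m X w) j k - n%:R * Sigma j k|] `<=`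
    bad 1 `|` bad (-1).
  move=> w /=; rewrite trmx_mul_entry /bad /=.
  have [H1|H1] := ltP (n%:R * v 1 * t) `|U 1 w - n%:R * v 1|; first by left.
  have [H2|H2] := ltP (n%:R * v (-1) * t) `|U (-1) w - n%:R * v (-1)|; first by right.
  have -> : \sum_i X w i j * X w i k = (U 1 w - U (-1) w) / 4.
    by rewrite /U -sumrB mulr_suml; apply: eq_bigr => i _; field.
  move=> H; exfalso; move: H1 H2 H; rewrite /v; set u1 := U 1 w; set u2 := U (-1) w.
  by rewrite ltNge => H1 H2 /negP; apply; move: H1 H2; rewrite !ler_norml; lra.
apply: le_trans (le_measure _ _ _ sub) _; rewrite ?inE.
- by apply: measurable_gt_norm; exact: gram_entry_measurable.
- by apply: measurableU; exact: mbad.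
apply: le_trans (measureU2 _ _ _) _ => //.
rewrite (_ : 4 * expR _ = 2 * expR (- (n%:R * t ^+ 2 / 6)) +
  2 * expR (- (n%:R * t ^+ 2 / 6))); last by ring.
by rewrite EFinD; apply: leeD; exact: Pbad.
Qed.

End gram_tail.

Section noise.
Context d (T : measurableType d) (R : realType) (P : probability T R).
Variables (n p : nat) (sigma : R) (X : T -> 'M[R]_(n, p)) (eps : T -> 'cV[R]_n).
Hypotheses (mX : forall i j, measurable_fun setT (fun w => X w i j))
  (noise : centered_gaussian P ((sigma ^+ 2)%:M : 'M[R]_n) eps)
  (indep : independent2 P (sigma_generated X) (sigma_generated eps)).

Let T1 := g_sigma_algebraType (entry_events X).
Let T2 := g_sigma_algebraType (entry_events eps).

Lemma noise_entry_measurable i : measurable_fun setT (fun w => eps w i 0).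
Proof.
rewrite (_ : (fun w => eps w i 0) =
    (fun w => ((delta_mx i 0 : 'cV[R]_n)^T *m eps w) 0 0)).
  exact: (noise.2 (delta_mx i 0)).1.
by apply/funext => w; rewrite trmx_delta -rowE mxE.
Qed.

(** With X fixed, the linear form with coefficients a is normal and its
    variance is at most V on the event E of the sigma-algebra of X. *)
Lemma conditional_noise_tail (a : T -> 'cV[R]_n) (E : set T) (V tau : R) :
  (forall i, measurable_fun setT ((fun w => a w i 0) : T1 -> R)) ->
  measurable (E : set T1) -> 0 < V -> 0 <= tau ->
  (forall w, E w -> sigma ^+ 2 * \sum_i a w i 0 ^+ 2 <= V) ->
  (P [set w | E w /\ (tau < `|((a w)^T *m eps w) 0 0|)%R] <=
   (2 * expR (- (tau ^+ 2 / (2 * V))))%:E)%E.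
Proof.
move=> ma mE V0 tau0 aV.
pose f (z : T1 * T2) := ((a z.1)^T *m eps z.2) 0 0.
have mf : measurable_fun setT f.
  rewrite (_ : f = (fun z : T1 * T2 => \sum_i a z.1 i 0 * eps z.2 i 0)); last first.
    by apply/funext => z; rewrite /f linear_form_sum.
  apply: measurable_sum => i; apply: measurable_funM.
    by apply: (measurableT_comp (ma i)); exact: measurable_fst.
  apply: (measurableT_comp (f := (fun w => eps w i 0) : T2 -> R)).
    exact: entry_measurable_generated.
  exact: measurable_snd.
have mA := measurable_gt_norm tau mf.
apply: (independent_section_bound (entry_events_measurable mX) _ indep mA mE).
- apply: entry_events_measurable => i j; rewrite (ord1 j).
  exact: noise_entry_measurable.
- by rewrite lee_fin mulr_ge0 ?expR_ge0.
move=> x Ex; rewrite /f /=.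
apply: (@normal_tail _ _ _ P (quadform (sigma ^+ 2)%:M (a x))) => //.
- exact: noise.1.2.
- exact: noise.2.
- rewrite /quadform mul_mx_scalar -scalemxAl mxE linear_form_sum.
  exact: aV.
Qed.

End noise.

(** * Vectors and quadratic forms *)

Section vectors.
Context {R : realType}.

Lemma l1norm_subvec m (J : {set 'I_m}) (g : 'cV[R]_m) :
  l1norm (subvec J g) = \sum_(j in J) `|g j 0|.
Proof. by rewrite big_enum_val /l1norm; apply: eq_bigr => i _; rewrite mxE. Qed.

Lemma sqr_l2norm m (g : 'cV[R]_m) : l2norm g ^+ 2 = \sum_j g j 0 ^+ 2.
Proof. by rewrite sqr_sqrtr// sumr_ge0// => j _; exact: sqr_ge0. Qed.

Lemma sqr_l2norm_subvec m (J : {set 'I_m}) (g : 'cV[R]_m) :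
  l2norm (subvec J g) ^+ 2 = \sum_(j in J) g j 0 ^+ 2.
Proof. by rewrite sqr_l2norm [RHS]big_enum_val; apply: eq_bigr => i _; rewrite mxE. Qed.

Lemma l2norm_mulmx m (u : 'cV[R]_m) : l2norm u ^+ 2 = (u^T *m u) 0 0.
Proof. by rewrite sqr_l2norm linear_form_sum. Qed.

Lemma subvec_eq0 m (J : {set 'I_m}) (g : 'cV[R]_m) :
  subvec J g = 0 <-> (forall j, j \in J -> g j 0 = 0).
Proof.
split=> [H j jJ|H].
  have := congr1 (fun v : 'cV_#|J| => v (enum_rank_in jJ j) 0) H.
  by rewrite !mxE enum_rankK_in.
by apply/colP => i; rewrite !mxE H// enum_valP.
Qed.

Lemma sum_setC (I : finType) (J : {set I}) (F : I -> R) :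
  \sum_j F j = \sum_(j in J) F j + \sum_(j in ~: J) F j.
Proof.
rewrite (bigID (mem J))/=; congr (_ + _).
by apply: eq_bigl => j; rewrite inE.
Qed.

(** Expand the sum of the squares of #|J| F_j - sum F. *)
Lemma sqr_sum_le (I : finType) (J : {set I}) (F : I -> R) :
  (\sum_(j in J) F j) ^+ 2 <= #|J|%:R * \sum_(j in J) F j ^+ 2.
Proof.
set S1 := \sum_(j in J) F j; set S2 := \sum_(j in J) F j ^+ 2.
have [J0|J0] := eqVneq #|J| 0%N.
  by rewrite /S1 (cards0_eq J0) big_set0 expr0n/= cards0 mul0r.
have c0 : (0 : R) < #|J|%:R by rewrite ltr0n lt0n.
have : 0 <= \sum_(j in J) (#|J|%:R * F j - S1) ^+ 2.
  by apply: sumr_ge0 => j _; exact: sqr_ge0.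
under eq_bigr do rewrite sqrrB exprMn.
rewrite big_split/= sumrB -!mulr_sumr sumr_const -/S2.
rewrite (eq_bigr (fun j => (#|J|%:R * S1 *+ 2) * F j)); last first.
  by move=> j _; ring.
rewrite -mulr_sumr -/S1 -mulr_natl => H.
rewrite -subr_ge0 -(pmulr_rge0 _ c0).
by apply: le_trans H _; rewrite le_eqVlt; apply/orP; left; apply/eqP; ring.
Qed.

Lemma largest_outside_exists m (J : {set 'I_m}) (g : 'cV[R]_m) k :
  (k <= #|~: J|)%N -> exists Jm, m_largest_outside k J g Jm.
Proof.
elim: k => [_|k IH kJ].
  exists finset.set0; split; [exact: finset.sub0set|exact: cards0|].
  by move=> j k; rewrite inE.
have [Jm [JmJ cJm Jmax]] := IH (ltnW kJ).
have [j0 j0J] : exists j, j \in (~: J) :\: Jm.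
  apply/set0Pn; rewrite -card_gt0 cardsD (finset.setIidPr JmJ) cJm subn_gt0//.
pose j1 := [arg max_(j > j0 in (~: J) :\: Jm) `|g j 0|]%O.
have [j1J j1max] : j1 \in (~: J) :\: Jm /\
    forall j, j \in (~: J) :\: Jm -> `|g j 0| <= `|g j1 0|.
  by rewrite /j1; case: arg_maxP.
have /andP[j1Jm j1J'] : (j1 \notin Jm) && (j1 \in ~: J)
  by move: j1J; rewrite finset.in_setD.
exists (j1 |: Jm); split.
- by rewrite finset.subUset finset.sub1set j1J'.
- by rewrite cardsU1 j1Jm cJm.
move=> j l; rewrite !inE => /orP[/eqP->|jJm] lJ; rewrite negb_or => /andP[lj1 lJm].
  by apply: j1max; rewrite !inE lJm.
exact: Jmax.
Qed.

Lemma quadform_sum m (A : 'M[R]_m) (g : 'cV[R]_m) :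
  quadform A g = \sum_j \sum_k g j 0 * A j k * g k 0.
Proof.
rewrite /quadform mxE exchange_big/=; apply: eq_bigr => k _.
by rewrite mxE mulr_suml; apply: eq_bigr => j _; rewrite mxE.
Qed.

Lemma quadform_perturbation m (A B : 'M[R]_m) (g : 'cV[R]_m) (t : R) :
  (forall j k, `|A j k - B j k| <= t) ->
  `|quadform A g - quadform B g| <= t * (\sum_j `|g j 0|) ^+ 2.
Proof.
move=> AB; rewrite !quadform_sum -sumrB.
apply: le_trans (ler_norm_sum _ _ _) _.
rewrite expr2 mulr_suml mulr_sumr; apply: ler_sum => j _.
rewrite -sumrB mulr_sumr mulr_sumr; apply: le_trans (ler_norm_sum _ _ _) _.
apply: ler_sum => k _.
have -> : g j 0 * A j k * g k 0 - g j 0 * B j k * g k 0 =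
  (A j k - B j k) * (g j 0 * g k 0) by ring.
by rewrite !normrM ler_wpM2r// mulr_ge0.
Qed.

End vectors.

(** * Restricted eigenvalues *)

Section restricted_eigenvalue.
Context {R : realType} {p : nat}.
Variables (Sigma : 'M[R]_p) (S : {set 'I_p}) (s : nat).
Hypotheses (psd : is_psd Sigma) (RE : RE_assumption S s s 3 Sigma).

Let kappa := RE_invK s s 3 Sigma.

Let kappa_gt0 : 0 < kappa. Proof. exact: RE_invK_gt0 RE. Qed.

Let RE_set : set R := [set r |
  exists (J0 : {set 'I_p}) (g : 'cV[R]_p) (Jm : {set 'I_p}), [/\ (#|J0| <= s)%N, g != 0,
    l1norm (subvec (~: J0)%SET g) <= 3 * l1norm (subvec J0 g),
    m_largest_outside s J0 g Jm &
    r = l2norm (sqrtmx Sigma *m g) / l2norm (subvec (J0 :|: Jm)%SET g)]].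

Let RE_set_lb : lbound RE_set 0.
Proof. by move=> _ [J0 [g [Jm [_ _ _ _ ->]]]]; rewrite divr_ge0 ?sqrtr_ge0. Qed.

Let kappa_le r : RE_set r -> kappa <= r.
Proof. by apply: ge_inf; exists 0; exact: RE_set_lb. Qed.

Let card_setC (J : {set 'I_p}) : (#|J| <= s)%N -> (s <= #|~: J|)%N.
Proof.
move=> Js; rewrite cardsCs finset.setCK card_ord leq_subRL.
  by rewrite (leq_trans _ (RE_s_half RE))// mul2n -addnn leq_add2r.
exact: leq_trans (leq_trans Js (leq_pmull s (ltn0Sn 1))) (RE_s_half RE).
Qed.

Let p_gt0 : (0 < p)%N.
Proof. by have := RE_s_half RE; have := RE_s_gt0 RE; lia. Qed.

Let j0 : 'I_p := Ordinal p_gt0.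
Let e0 : 'cV[R]_p := delta_mx j0 0.

Let e0_neq0 : e0 != 0.
Proof.
apply/eqP => /(congr1 (fun v : 'cV_p => v j0 0)).
by rewrite !mxE !eqxx => /eqP; rewrite oner_eq0.
Qed.

Let e0_out j : j \in (~: [set j0])%SET -> e0 j 0 = 0.
Proof. by rewrite !inE mxE => /negbTE ->. Qed.

Let e0_cone : l1norm (subvec (~: [set j0])%SET e0) <= 3 * l1norm (subvec [set j0]%SET e0).
Proof.
rewrite !l1norm_subvec big1 ?mulr_ge0 ?sumr_ge0// => j jC.
by rewrite e0_out// normr0.
Qed.

Let RE_set_e0 : exists Jm, m_largest_outside s [set j0]%SET e0 Jm.
Proof.
by apply: largest_outside_exists; apply: card_setC; rewrite cards1 (RE_s_gt0 RE).
Qed.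

(* Without a square root of Sigma, sqrtmx would take its default value 0 and
   the infimum would be 0, not positive. *)
Let sqrtmx_spec : is_psd (sqrtmx Sigma) /\ sqrtmx Sigma *m sqrtmx Sigma = Sigma.
Proof.
have [[B HB]|nB] := pselect (exists B : 'M[R]_p, is_psd B /\ B *m B = Sigma).
  exact: (@xgetPex _ 0 [set B : 'M[R]_p | is_psd B /\ B *m B = Sigma] (ex_intro _ B HB)).
have E : sqrtmx Sigma = 0 by apply: xgetPN => B HB; apply: nB; exists B.
have [Jm HJm] := RE_set_e0.
suff : kappa <= 0 by rewrite leNgt kappa_gt0.
apply: kappa_le; exists [set j0]%SET, e0, Jm; split => //.
  by rewrite cards1 (RE_s_gt0 RE).
rewrite E mul0mx /l2norm big1 ?sqrtr0 ?mul0r// => j _.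
by rewrite mxE expr0n.
Qed.

Let sqr_l2norm_sqrtmx (g : 'cV[R]_p) : l2norm (sqrtmx Sigma *m g) ^+ 2 = quadform Sigma g.
Proof.
have [[BT _] BB] := sqrtmx_spec.
by rewrite l2norm_mulmx trmx_mul BT /quadform -{3}BB !mulmxA.
Qed.

Lemma RE_bound (J Jm : {set 'I_p}) (g : 'cV[R]_p) :
  (#|J| <= s)%N -> \sum_(j in ~: J) `|g j 0| <= 3 * \sum_(j in J) `|g j 0| ->
  m_largest_outside s J g Jm ->
  kappa ^+ 2 * \sum_(j in J :|: Jm) g j 0 ^+ 2 <= quadform Sigma g.
Proof.
move=> Js cone HJm; have [->|g0] := eqVneq g 0.
  rewrite big1 ?mulr0; last by move=> j _; rewrite mxE expr0n.
  by rewrite /quadform mulmx0 mxE.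
rewrite -sqr_l2norm_subvec -sqr_l2norm_sqrtmx -exprMn.
set x := l2norm (subvec _ g).
have x0 : 0 <= x by exact: sqrtr_ge0.
apply: lerXn2r; rewrite ?nnegrE ?mulr_ge0 ?sqrtr_ge0// ?(ltW kappa_gt0)//.
have [->|xn0] := eqVneq x 0; first by rewrite mulr0 sqrtr_ge0.
rewrite -ler_pdivlMr ?lt_def ?xn0//.
by apply: kappa_le; exists J, g, Jm; split=> //; rewrite !l1norm_subvec.
Qed.

(** Test the infimum at a basis vector, whose quotient is 1 since Sigma has unit
    diagonal. *)
Lemma RE_invK_le1 : kappa <= 1.
Proof.
have [Jm HJm] := RE_set_e0.
have : kappa ^+ 2 * \sum_(j in [set j0]%SET :|: Jm) e0 j 0 ^+ 2 <= quadform Sigma e0.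
  apply: RE_bound => //; first by rewrite cards1 (RE_s_gt0 RE).
  by rewrite -!l1norm_subvec.
rewrite /quadform bilinear_delta (RE_diag RE) (bigD1 j0) ?inE ?eqxx//= big1; last first.
  by move=> j /andP[_ jj0]; rewrite e0_out ?inE// expr0n.
rewrite mxE !eqxx expr1n addr0 mulr1 => H.
by rewrite -(@expr_le1 _ 2)// ltW.
Qed.

Let eig_set : set R := [set r |
  exists (J0 : {set 'I_p}) (g : 'cV[R]_p), [/\ (#|J0| <= s)%N, g != 0,
    subvec (~: J0)%SET g = 0 &
    r = quadform Sigma g / l2norm (subvec J0 g) ^+ 2]].

Let Lambda := Lambda_min Sigma s.

Let LambdaE : 17 * Lambda / 16 = inf eig_set.
Proof. by rewrite /Lambda /Lambda_min -/eig_set; field. Qed.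

Let sparse_sum_gt0 (J : {set 'I_p}) (g : 'cV[R]_p) : g != 0 ->
  (forall j, j \in (~: J)%SET -> g j 0 = 0) -> 0 < \sum_(j in J) g j 0 ^+ 2.
Proof.
move=> g0 gJ; rewrite lt_def sumr_ge0 ?andbT; last by move=> j _; exact: sqr_ge0.
apply: contra g0; rewrite psumr_eq0; last by move=> j _; exact: sqr_ge0.
move=> /allP H; apply/eqP/colP => j; rewrite mxE.
have [jJ|jJ] := boolP (j \in J); last by rewrite gJ// inE.
by have := H j (mem_index_enum _); rewrite jJ sqrf_eq0 => /eqP.
Qed.

Lemma Lambda_min_bound (J : {set 'I_p}) (g : 'cV[R]_p) :
  (#|J| <= s)%N -> (forall j, j \notin J -> g j 0 = 0) ->
  17 / 16 * Lambda * \sum_j g j 0 ^+ 2 <= quadform Sigma g.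
Proof.
move=> Js gJ; have [->|g0] := eqVneq g 0.
  rewrite big1 ?mulr0; last by move=> j _; rewrite mxE expr0n.
  by rewrite /quadform mulmx0 mxE.
have gJ' j : j \in (~: J)%SET -> g j 0 = 0 by rewrite inE; exact: gJ.
rewrite (sum_setC J) [X in _ + X]big1 ?addr0; last first.
  by move=> j jJ; rewrite gJ'// expr0n.
have := sparse_sum_gt0 g0 gJ' => sum0.
rewrite -ler_pdivlMr//.
have -> : 17 / 16 * Lambda = inf eig_set by rewrite -LambdaE; field.
apply: ge_inf.
  exists 0 => _ [J' [g' [_ _ _ ->]]].
  by rewrite divr_ge0 ?exprn_ge0 ?sqrtr_ge0//; exact: psd.2.
exists J, g; split=> //; first exact/subvec_eq0.
by rewrite sqr_l2norm_subvec.
Qed.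

(** A vector supported on J lies in the cone of J, so the restricted eigenvalue
    is also a sparse eigenvalue. *)
Lemma RE_invK_sqr_le_Lambda_min : kappa ^+ 2 <= 17 / 16 * Lambda.
Proof.
have -> : 17 / 16 * Lambda = inf eig_set by rewrite -LambdaE; field.
apply: lb_le_inf.
  exists (quadform Sigma e0 / l2norm (subvec [set j0]%SET e0) ^+ 2).
  exists [set j0]%SET, e0; split=> //; first by rewrite cards1 (RE_s_gt0 RE).
  by apply/subvec_eq0; exact: e0_out.
move=> _ [J [g [Js g0 /subvec_eq0 gJ ->]]].
rewrite sqr_l2norm_subvec ler_pdivlMr ?sparse_sum_gt0//.
have [Jm HJm] := largest_outside_exists g (card_setC Js).
apply: le_trans (RE_bound Js _ HJm).
  rewrite ler_pM2l ?exprn_gt0// [leRHS](bigID (mem J))/=.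
  rewrite [X in _ <= X + _](eq_bigl (mem J)) ?lerDl ?sumr_ge0//.
    by move=> j _; exact: sqr_ge0.
  by move=> j; rewrite !inE andbC; case: (j \in J).
by rewrite big1 ?mulr_ge0 ?sumr_ge0// => j jJ; rewrite gJ// normr0.
Qed.

End restricted_eigenvalue.

(** * From the covariance to the Gram matrix *)

Section gram.
Context {R : realType} {n p : nat}.
Implicit Types (X : 'M[R]_(n, p)) (Y : 'cV[R]_n) (b g : 'cV[R]_p).

Definition gram X : 'M[R]_p := n%:R^-1 *: (X^T *m X).

(** The gradient of minus the least squares loss. *)
Definition score X Y b : 'cV[R]_p := n%:R^-1 *: (X^T *m (Y - X *m b)).

Lemma quadform_gram X g : quadform (gram X) g = n%:R^-1 * l2norm (X *m g) ^+ 2.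
Proof.
by rewrite l2norm_mulmx /quadform /gram -scalemxAr -scalemxAl mxE trmx_mul !mulmxA.
Qed.

Lemma quadform_gram_ge0 X g : 0 <= quadform (gram X) g.
Proof. by rewrite quadform_gram mulr_ge0 ?invr_ge0 ?sqr_ge0. Qed.

(** The least squares loss is quadratic, so its second order expansion is exact
    at every point; it is used at beta for the initial estimator and at the
    candidate for the adaptive one. *)
Lemma loss_expansion X Y b0 b :
  (2 * n%:R)^-1 * l2norm (Y - X *m b) ^+ 2 =
  (2 * n%:R)^-1 * l2norm (Y - X *m b0) ^+ 2
  - \sum_j score X Y b0 j 0 * (b - b0) j 0 + quadform (gram X) (b - b0) / 2.
Proof.
rewrite -linear_form_sum quadform_gram /score.
set r := Y - X *m b0; set dlt := b - b0.
have -> : Y - X *m b = r - X *m dlt.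
  by rewrite /r /dlt mulmxBr opprB addrA subrK.
have l2B (u v : 'cV[R]_n) :
    l2norm (u - v) ^+ 2 = l2norm u ^+ 2 - 2 * (u^T *m v) 0 0 + l2norm v ^+ 2.
  rewrite !sqr_l2norm linear_form_sum mulr_sumr -sumrB -big_split/=.
  by apply: eq_bigr => i _; rewrite !mxE; ring.
rewrite l2B.
have -> : ((n%:R^-1 *: (X^T *m r))^T *m dlt) 0 0 = n%:R^-1 * (r^T *m (X *m dlt)) 0 0.
  rewrite linearZ/= -scalemxAl mxE trmx_mul trmxK mulmxA//.
by rewrite invfM; set N := n%:R^-1; field.
Qed.

Variables (Sigma : 'M[R]_p) (S : {set 'I_p}) (s : nat) (X : 'M[R]_(n, p)) (t : R).
Hypotheses (psd : is_psd Sigma) (RE : RE_assumption S s s 3 Sigma)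
  (t0 : 0 <= t) (close : forall j k, `|gram X j k - Sigma j k| <= t)
  (st : s%:R * t <= RE_invK s s 3 Sigma ^+ 2 / 32).

Let kappa := RE_invK s s 3 Sigma.

Let l1_sqr_le (J : {set 'I_p}) g (c : R) : (#|J| <= s)%N -> 0 <= c ->
  \sum_j `|g j 0| <= c * \sum_(j in J) `|g j 0| ->
  (\sum_j `|g j 0|) ^+ 2 <= c ^+ 2 * (s%:R * \sum_(j in J) g j 0 ^+ 2).
Proof.
move=> Js c0 H.
apply: (@le_trans _ _ ((c * \sum_(j in J) `|g j 0|) ^+ 2)).
  by apply: lerXn2r; rewrite ?nnegrE ?mulr_ge0 ?sumr_ge0.
rewrite exprMn ler_wpM2l ?exprn_ge0//.
apply: le_trans (sqr_sum_le _ _) _.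
under eq_bigr do rewrite real_normK ?num_real//.
by rewrite ler_wpM2r ?ler_nat// sumr_ge0// => j _; exact: sqr_ge0.
Qed.

(** On the cone the l1 norm of g is at most 4 times its part on J, so the
    perturbation costs 16 t s <= kappa^2 / 2 times the squared norm on J. *)
Lemma gram_RE (J Jm : {set 'I_p}) g :
  (#|J| <= s)%N -> \sum_(j in ~: J) `|g j 0| <= 3 * \sum_(j in J) `|g j 0| ->
  m_largest_outside s J g Jm ->
  kappa ^+ 2 / 2 * \sum_(j in J :|: Jm) g j 0 ^+ 2 <= quadform (gram X) g.
Proof.
move=> Js cone HJm.
have re := RE_bound RE Js cone HJm.
have pert := quadform_perturbation g close.
have l1 : \sum_j `|g j 0| <= 4 * \sum_(j in J) `|g j 0|.
  by rewrite (sum_setC J); lra.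
have l1s := l1_sqr_le Js (ler0n _ 4) l1.
have sub : \sum_(j in J) g j 0 ^+ 2 <= \sum_(j in J :|: Jm) g j 0 ^+ 2.
  rewrite [leRHS](bigID (mem J))/= [X in _ <= X + _](eq_bigl (mem J)).
    by rewrite lerDl sumr_ge0// => j _; exact: sqr_ge0.
  by move=> j; rewrite !inE andbC; case: (j \in J).
have s0 : 0 <= \sum_(j in J) g j 0 ^+ 2 by apply: sumr_ge0 => j _; exact: sqr_ge0.
have : t * (\sum_j `|g j 0|) ^+ 2 <= kappa ^+ 2 / 2 * \sum_(j in J :|: Jm) g j 0 ^+ 2.
  apply: le_trans (ler_wpM2l t0 l1s) _.
  rewrite [leLHS](_ : _ = 16 * (s%:R * t) * \sum_(j in J) g j 0 ^+ 2); last by ring.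
  apply: ler_pM => //; last by move: st; rewrite -/kappa; lra.
  by rewrite !mulr_ge0.
move: pert re; rewrite ler_norml -/kappa; lra.
Qed.

(** Here the perturbation costs s t <= kappa^2 / 32, at most 1/32 of the sparse
    eigenvalue (17/16) Lambda_min, and (17/16) (31/32) >= 1. *)
Lemma gram_sparse_bound g :
  (#|S| <= s)%N -> (forall j, j \notin S -> g j 0 = 0) ->
  Lambda_min Sigma s * \sum_j g j 0 ^+ 2 <= quadform (gram X) g.
Proof.
move=> Ss gS.
have low := Lambda_min_bound psd Ss gS.
have pert := quadform_perturbation g close.
have kL := RE_invK_sqr_le_Lambda_min RE.
have l1 : \sum_j `|g j 0| <= 1 * \sum_(j in S) `|g j 0|.
  rewrite (sum_setC S) [X in _ + X]big1 ?addr0 ?mul1r// => j.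
  by rewrite inE => /gS ->; rewrite normr0.
have l1s := l1_sqr_le Ss ler01 l1.
have sE : \sum_(j in S) g j 0 ^+ 2 = \sum_j g j 0 ^+ 2.
  rewrite (sum_setC S) [X in _ = _ + X]big1 ?addr0// => j.
  by rewrite inE => /gS ->; rewrite expr0n.
rewrite sE in l1s.
have s0 : 0 <= \sum_j g j 0 ^+ 2 by apply: sumr_ge0 => j _; exact: sqr_ge0.
have : t * (\sum_j `|g j 0|) ^+ 2 <=
    (17 / 16 * Lambda_min Sigma s) / 32 * \sum_j g j 0 ^+ 2.
  apply: le_trans (ler_wpM2l t0 l1s) _.
  rewrite [leLHS](_ : _ = (s%:R * t) * \sum_j g j 0 ^+ 2); last by ring.
  apply: ler_wpM2r => //; move: st kL; rewrite -/kappa; lra.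
have L0 : 0 <= Lambda_min Sigma s.
  by have := RE_Lambda_gt0 RE; lra.
have := mulr_ge0 L0 s0.
move: pert low; rewrite ler_norml; lra.
Qed.

End gram.

(** * The initial Lasso *)

Section lasso.
Context {R : realType} {n p : nat}.
Variables (X : 'M[R]_(n, p)) (Y : 'cV[R]_n) (beta b : 'cV[R]_p).
Variables (S : {set 'I_p}) (s : nat) (lambda K2 : R).
Hypotheses (betaS : forall j, j \notin S -> beta j 0 = 0) (cardS : #|S| = s)
  (s_gt0 : (0 < s)%N) (s_le : (s <= #|~: S|)%N)
  (lambda0 : 0 < lambda) (K20 : 0 < K2)
  (score_le : forall j, `|score X Y beta j 0| <= lambda / 2)
  (cone_bound : forall (Jm : {set 'I_p}) (g : 'cV[R]_p),
    \sum_(j in ~: S) `|g j 0| <= 3 * \sum_(j in S) `|g j 0| ->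
    m_largest_outside s S g Jm ->
    \sum_(j in S :|: Jm) g j 0 ^+ 2 <= K2 * quadform (gram X) g)
  (lasso : is_lasso X Y lambda b).

Let v := b - beta.
Let a := \sum_(j in S) `|v j 0|.
Let c := \sum_(j in ~: S) `|v j 0|.
Let Q := quadform (gram X) v.

Let a0 : 0 <= a. Proof. by apply: sumr_ge0. Qed.
Let c0 : 0 <= c. Proof. by apply: sumr_ge0. Qed.

(* Compare the objective at b and at beta; the score is absorbed by half of the
   penalty. *)
Let basic_inequality : Q + lambda * c <= 3 * lambda * a.
Proof.
have [_ /(_ beta I)] := lasso; rewrite (loss_expansion X Y beta b) -/v -/Q.
set L0 := _ * l2norm _ ^+ 2; set C := \sum_j score _ _ _ _ _ * _ => H.
have C_le : C <= lambda / 2 * (a + c).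
  rewrite -sum_setC mulr_sumr; apply: ler_sum => j _.
  apply: le_trans (ler_norm _) _; rewrite normrM.
  by apply: ler_wpM2r.
have l1 : l1norm beta - l1norm b <= a - c.
  rewrite /l1norm (sum_setC S) (sum_setC S (fun j => `|b j 0|)).
  have in_S : \sum_(j in S) `|beta j 0| <= a + \sum_(j in S) `|b j 0|.
    rewrite /a -big_split/=; apply: ler_sum => j _; rewrite /v !mxE.
    by have := ler_normB (b j 0) (b j 0 - beta j 0); rewrite subKr addrC.
  have off_S : \sum_(j in ~: S) `|b j 0| = c.
    apply: eq_bigr => j; rewrite inE => jS.
    by rewrite /v !mxE betaS// subr0.
  have -> : \sum_(j in ~: S) `|beta j 0| = 0.
    by apply: big1 => j; rewrite inE => /betaS ->; rewrite normr0.
  rewrite off_S; lra.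
have := ler_wpM2l (ltW lambda0) l1; lra.
Qed.

Let Q0 : 0 <= Q. Proof. exact: quadform_gram_ge0. Qed.

Let cone : c <= 3 * a.
Proof.
rewrite -(ler_pM2l lambda0); have := basic_inequality; have := Q0; lra.
Qed.

Let exists_largest : exists Jm, m_largest_outside s S v Jm.
Proof. exact: largest_outside_exists. Qed.

Let a_sqr Jm : m_largest_outside s S v Jm ->
  a ^+ 2 <= s%:R * \sum_(j in S :|: Jm) v j 0 ^+ 2.
Proof.
move=> _; apply: le_trans (sqr_sum_le _ _) _; rewrite cardS ler_wpM2l//.
under eq_bigr do rewrite real_normK ?num_real//.
rewrite [leRHS](bigID (mem S))/= [X in _ <= X + _](eq_bigl (mem S)).
  by rewrite lerDl sumr_ge0// => j _; exact: sqr_ge0.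
by move=> j; rewrite !inE andbC; case: (j \in S).
Qed.

Let s0 : (0 : R) < s%:R. Proof. by rewrite ltr0n. Qed.

Let a_sqr_Q : a ^+ 2 <= s%:R * K2 * Q.
Proof.
have [Jm HJm] := exists_largest.
apply: le_trans (a_sqr HJm) _; rewrite -mulrA; apply: ler_wpM2l; first exact: ltW.
exact: cone_bound.
Qed.

(** From Q + lambda c <= 3 lambda a and a^2 <= s K2 Q: the quadratic
    3 lambda a - a^2 / (s K2) in a is at most (9/4) lambda^2 s K2. *)
Lemma lasso_l1_off_support :
  \sum_(j in ~: S) `|(b - beta) j 0| <= 9 / 4 * K2 * lambda * s%:R.
Proof.
rewrite -/v -/c; set m := s%:R * K2.
have m0 : 0 < m by rewrite mulr_gt0.
rewrite -(ler_pM2l lambda0) -(ler_pM2l m0).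
have := basic_inequality; rewrite -(ler_pM2l m0).
have := a_sqr_Q; rewrite -/m.
have := sqr_ge0 (3 / 2 * lambda * m - a).
have -> : m * (lambda * (9 / 4 * K2 * lambda * s%:R)) = 9 / 4 * lambda ^+ 2 * m ^+ 2.
  by rewrite /m; field.
by nra.
Qed.

(** A coordinate outside S and outside the s largest ones is dominated by one of
    these, so the l2 bound on S and the s largest coordinates bounds every
    coordinate. *)
Lemma lasso_sup_error j : `|(b - beta) j 0| <= 3 * K2 * lambda * Num.sqrt s%:R.
Proof.
have [Jm HJm] := exists_largest; have [JmS cJm Jmax] := HJm.
set W := \sum_(j in S :|: Jm) v j 0 ^+ 2.
have WQ : W <= K2 * Q by exact: cone_bound.
have Qa : Q <= 3 * lambda * a.
  have := basic_inequality; have := mulr_ge0 (ltW lambda0) c0; lra.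
have a_le : a <= 3 * lambda * (s%:R * K2).
  have m0 : 0 < s%:R * K2 by rewrite mulr_gt0.
  have [->|an0] := eqVneq a 0; first by rewrite mulr_ge0 ?mulr_ge0 ?ltW.
  have apos : 0 < a by rewrite lt_def an0.
  rewrite -(ler_pM2l apos); have := a_sqr_Q.
  have := ler_wpM2l (ltW m0) Qa; lra.
have W_le : W <= (3 * K2 * lambda * Num.sqrt s%:R) ^+ 2.
  rewrite exprMn sqr_sqrtr ?(ltW s0)//.
  have := ler_wpM2l (ltW K20) Qa.
  have K2l : 0 <= K2 * (3 * lambda) by rewrite !mulr_ge0 ?ltW.
  have := ler_wpM2l K2l a_le; lra.
have in_W k : k \in S :|: Jm -> `|v k 0| <= 3 * K2 * lambda * Num.sqrt s%:R.
  move=> kSJ; have bound0 : 0 <= 3 * K2 * lambda * Num.sqrt s%:R.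
    by rewrite !mulr_ge0// ltW.
  rewrite -(@ler_pXn2r _ 2)//.
  apply: le_trans W_le; rewrite real_normK ?num_real// /W (bigD1 k)//= lerDl.
  by apply: sumr_ge0 => l _; exact: sqr_ge0.
rewrite -/v; have [jSJ|] := boolP (j \in S :|: Jm); first exact: in_W.
rewrite finset.in_setU negb_or => /andP[jS jJm].
have [k kJm] : exists k, k \in Jm by apply/set0Pn; rewrite -card_gt0 cJm.
by apply: le_trans (Jmax k j kJm jS jJm) _; apply: in_W; rewrite inE kJm orbT.
Qed.

(** Each index selected outside S contributes more than 4 lambda to the l1
    error outside S. *)
Lemma lasso_selected_bounds : (forall j, j \in S -> 4 * lambda < `|b j 0|) ->
  s%:R <= #|[set j | 4 * lambda < `|b j 0|]%SET|%:R :> R /\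
  #|[set j | 4 * lambda < `|b j 0|]%SET|%:R <= s%:R * (1 + 9 / 16 * K2).
Proof.
move=> bS; set B := [set j | _]%SET.
have SB : S \subset B by apply/fintype.subsetP => j jS; rewrite inE bS.
split; first by rewrite ler_nat -cardS subset_leq_card.
have -> : #|B| = (s + #|B :\: S|)%N.
  by rewrite cardsD (finset.setIidPr SB) cardS subnKC// -cardS subset_leq_card.
rewrite natrD mulrDr mulr1 lerD2l.
have l4 : 0 < 4 * lambda by rewrite mulr_gt0.
rewrite -(ler_pM2l l4).
apply: le_trans (_ : _ <= 9 / 4 * K2 * lambda * s%:R) _; last by lra.
apply: le_trans lasso_l1_off_support.
rewrite mulr_natr -sumr_const.
apply: (@le_trans _ _ (\sum_(j in B :\: S) `|v j 0|)).
  apply: ler_sum => j; rewrite !inE => /andP[jS /ltW].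
  by rewrite /v !mxE betaS// subr0.
rewrite [leRHS](bigID (mem (B :\: S)))/= [X in _ <= X + _](eq_bigl (mem (B :\: S))).
  by rewrite lerDl sumr_ge0.
by move=> j; rewrite !inE; case: (j \in S).
Qed.

End lasso.

(** * Support recovery by the adaptive Lasso *)

Section support_solve.
Context {R : realType} {p : nat}.
Variables (A : 'M[R]_p) (S : {set 'I_p}).

(** The block of A on S, completed by the identity outside S. *)
Definition block_mx_on : 'M[R]_p :=
  \matrix_(i, j) if (i \in S) && (j \in S) then A i j else (i == j)%:R.

Definition mask_col (y : 'cV[R]_p) : 'cV[R]_p :=
  \col_i if i \in S then y i 0 else 0.

(** The vector supported on S whose image under A agrees with y on S, by
    Cramer's rule; in this form its entries are visibly rational functions of
    those of A, hence measurable. *)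
Definition support_solve (y : 'cV[R]_p) : 'cV[R]_p :=
  (\det block_mx_on)^-1 *: (\adj block_mx_on *m mask_col y).

Let block_mulE (x : 'cV[R]_p) i :
  (block_mx_on *m x) i 0 = if i \in S then \sum_(j in S) A i j * x j 0 else x i 0.
Proof.
rewrite mxE; case: ifP => iS.
  rewrite (sum_setC S) [X in _ + X]big1 ?addr0.
    by apply: eq_bigr => j jS; rewrite mxE iS jS.
  move=> j; rewrite inE => jS; rewrite mxE iS (negbTE jS)/=.
  by case: eqP jS => [<-|]; rewrite ?iS ?mul0r.
rewrite (bigD1 i)//= mxE iS eqxx mul1r big1 ?addr0// => j ji.
by rewrite mxE iS eq_sym (negbTE ji) mul0r.
Qed.

Hypothesis definite : forall v : 'cV[R]_p, (forall j, j \notin S -> v j 0 = 0) ->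
  quadform A v = 0 -> v = 0.

Let det_neq0 : \det block_mx_on != 0.
Proof.
rewrite -unitfE -unitmxE -unitmx_tr -row_free_unit; apply: inj_row_free => v vG.
suff : v^T = 0 by move=> /(congr1 trmx); rewrite trmxK trmx0.
have Gv : block_mx_on *m v^T = 0.
  by rewrite -[LHS]trmxK trmx_mul trmxK vG trmx0.
have out j : j \notin S -> v^T j 0 = 0.
  by move=> jS; have := block_mulE v^T j; rewrite (negbTE jS) Gv mxE.
apply: definite => //; rewrite quadform_sum big1// => j _.
have [jS|jS] := boolP (j \in S); last by rewrite big1// => k _; rewrite out// !mul0r.
under eq_bigr do rewrite -mulrA.
rewrite -mulr_sumr (sum_setC S) [X in _ + X]big1 ?addr0; last first.
  by move=> k; rewrite inE => kS; rewrite out// mulr0.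
by have := block_mulE v^T j; rewrite jS Gv mxE => <-; rewrite mulr0.
Qed.

Let block_solve y : block_mx_on *m support_solve y = mask_col y.
Proof.
by rewrite -scalemxAr mulmxA mul_mx_adj mul_scalar_mx scalerA mulVf// scale1r.
Qed.

Lemma support_solve_out y j : j \notin S -> support_solve y j 0 = 0.
Proof.
move=> jS; have := block_mulE (support_solve y) j.
by rewrite block_solve mxE (negbTE jS) => <-.
Qed.

Lemma support_solve_in y j : j \in S -> (A *m support_solve y) j 0 = y j 0.
Proof.
move=> jS; have := block_mulE (support_solve y) j.
rewrite block_solve mxE jS => ->; rewrite mxE (sum_setC S) [X in _ + X]big1 ?addr0//.
by move=> k; rewrite inE => kS; rewrite support_solve_out// mulr0.
Qed.

End support_solve.

Section adaptive.
Context {R : realType} {n p : nat}.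
Variables (X : 'M[R]_(n, p)) (Y : 'cV[R]_n) (S : {set 'I_p}).
Hypothesis definite : forall v : 'cV[R]_p, (forall j, j \notin S -> v j 0 = 0) ->
  quadform (gram X) v = 0 -> v = 0.

(** The hypotheses are the subgradient conditions at bt, with slack outside S.
    In the expansion of the objective at bt every term of b minus bt is then
    nonnegative, and a minimizer makes all of them vanish: the slack forces
    b_j = 0 outside S, and definiteness on S does the rest. *)
Lemma adaptive_lasso_unique (lambda : R) (w : 'I_p -> \bar R) (bt b : 'cV[R]_p) :
  (forall j, j \in S -> (w j != +oo)%E /\
     score X Y bt j 0 * bt j 0 = lambda * fine (w j) * `|bt j 0| /\
     `|score X Y bt j 0| <= lambda * fine (w j)) ->
  (forall j, j \notin S -> bt j 0 = 0) ->
  (forall j, j \notin S -> (w j != +oo)%E ->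
     `|score X Y bt j 0| < lambda * fine (w j)) ->
  is_adaptive_lasso X Y lambda w b -> b = bt.
Proof.
move=> inS outS strict [b_feas b_min].
have bt_feas j : w j = +oo%E -> bt j 0 = 0.
  move=> wj; apply: outS; apply/negP => jS.
  by have [/eqP] := inS j jS; rewrite wj.
have := b_min bt bt_feas; rewrite (loss_expansion X Y bt b).
set L0 := _ * l2norm _ ^+ 2; set Q := quadform _ _ => H.
have Q0 : 0 <= Q by exact: quadform_gram_ge0.
pose F j := lambda * fine (w j) * `|b j 0| - lambda * fine (w j) * `|bt j 0|
  - score X Y bt j 0 * (b - bt) j 0.
have sumF : Q / 2 + \sum_j F j <= 0.
  rewrite !sumrB; move: H; rewrite !mulr_sumr.
  under [X in _ + X <= _ -> _]eq_bigr do rewrite mulrA.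
  under [X in _ <= _ + X -> _]eq_bigr do rewrite mulrA.
  lra.
have dE j : (b - bt) j 0 = b j 0 - bt j 0 by rewrite !mxE.
have F0 j : 0 <= F j.
  rewrite /F dE mulrBr; have [jS|jS] := boolP (j \in S).
    have [_ [-> g_le]] := inS j jS.
    have : score X Y bt j 0 * b j 0 <= lambda * fine (w j) * `|b j 0|.
      apply: le_trans (ler_norm _) _; rewrite normrM.
      by apply: ler_wpM2r.
    by lra.
  rewrite outS// normr0 !mulr0 !subr0.
  have [/b_feas ->|wj] := eqVneq (w j) +oo%E.
    by rewrite normr0 !mulr0 subrr.
  have g_lt := strict j jS wj.
  rewrite subr_ge0; apply: le_trans (ler_norm _) _; rewrite normrM.
  by apply: ler_wpM2r => //; exact: ltW.
have sF0 : 0 <= \sum_j F j by apply: sumr_ge0 => j _; exact: F0.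
have Q_eq0 : Q = 0 by lra.
have sF_eq0 : \sum_j F j = 0 by lra.
have Fj_eq0 j : F j = 0.
  by apply/eqP; move/eqP: sF_eq0; rewrite psumr_eq0// => /allP/(_ j (mem_index_enum _)).
apply/eqP; rewrite -subr_eq0; apply/eqP; apply: definite => // j jS.
rewrite dE outS// subr0.
have [/b_feas //|wj] := eqVneq (w j) +oo%E.
have g_lt := strict j jS wj.
have := Fj_eq0 j; rewrite /F dE outS// normr0 mulr0 !subr0 => /eqP.
rewrite subr_eq0 => /eqP E; apply/eqP; rewrite -normr_eq0; apply/negPn/negP => bj.
have bj0 : 0 < `|b j 0| by rewrite lt_def bj normr_ge0.
move: g_lt; rewrite -(ltr_pM2r bj0) E -normrM => /(le_lt_trans (ler_norm _)).
by rewrite ltxx.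
Qed.

End adaptive.

Lemma col_subE (R : realType) p (x y : 'cV[R]_p) k : (x - y) k 0 = x k 0 - y k 0.
Proof. by rewrite !mxE. Qed.

Section selection.
Context {R : realType} {n p : nat}.
Variables (X : 'M[R]_(n, p)) (Y : 'cV[R]_n) (beta : 'cV[R]_p) (Lambda : R).
Hypothesis Lambda0 : 0 < Lambda.

Let S := supp beta.
Let A := gram X.
Let z := score X Y beta.

Hypothesis sparse_bound : forall g : 'cV[R]_p, (forall j, j \notin S -> g j 0 = 0) ->
  Lambda * \sum_j g j 0 ^+ 2 <= quadform A g.

Let definite (g : 'cV[R]_p) : (forall j, j \notin S -> g j 0 = 0) ->
  quadform A g = 0 -> g = 0.
Proof.
move=> gS qg; have := sparse_bound gS; rewrite qg => H.
have sum0 : \sum_j g j 0 ^+ 2 = 0.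
  apply/eqP; rewrite eq_le sumr_ge0 ?andbT; last by move=> j _; exact: sqr_ge0.
  by rewrite -(ler_pM2l Lambda0) mulr0.
apply/colP => j; rewrite mxE; apply/eqP; rewrite -sqrf_eq0.
move/eqP: sum0; rewrite psumr_eq0; last by move=> k _; exact: sqr_ge0.
by move=> /allP/(_ j (mem_index_enum _)).
Qed.

Let quadform_mulmx (g : 'cV[R]_p) : quadform A g = \sum_j g j 0 * (A *m g) j 0.
Proof. by rewrite /quadform -mulmxA linear_form_sum. Qed.

(* From Lambda U <= m l and l^2 <= s U, where l and U are the l1 norm and the
   squared l2 norm of the solution. *)
Let support_solve_le (y : 'cV[R]_p) (m : R) k :
  (forall j, j \in S -> `|y j 0| <= m) -> 0 <= m ->
  `|support_solve A S y k 0| <= Num.sqrt #|S|%:R * m / Lambda.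
Proof.
move=> ym m0; set u := support_solve A S y.
have uS j : j \notin S -> u j 0 = 0 by exact: support_solve_out.
set l := \sum_(j in S) `|u j 0|; set U := \sum_j u j 0 ^+ 2.
have l0 : 0 <= l by exact: sumr_ge0.
have U0 : 0 <= U by apply: sumr_ge0 => j _; exact: sqr_ge0.
have UE : U = \sum_(j in S) `|u j 0| ^+ 2.
  rewrite /U (sum_setC S) [X in _ + X]big1 ?addr0.
    by apply: eq_bigr => j _; rewrite real_normK ?num_real.
  by move=> j; rewrite inE => /uS ->; rewrite expr0n.
have lU : l ^+ 2 <= #|S|%:R * U by rewrite UE; exact: sqr_sum_le.
have LU : Lambda * U <= m * l.
  apply: le_trans (sparse_bound uS) _; rewrite quadform_mulmx (sum_setC S).
  rewrite [X in _ + X]big1 ?addr0; last first.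
    by move=> j; rewrite inE => /uS ->; rewrite mul0r.
  rewrite /l mulr_sumr; apply: ler_sum => j jS; rewrite support_solve_in//.
  apply: le_trans (ler_norm _) _; rewrite normrM mulrC.
  by apply: ler_wpM2r => //; exact: ym.
have s0 : (0 : R) <= #|S|%:R by exact: ler0n.
have l_le : Lambda * l <= #|S|%:R * m.
  have [->|ln0] := eqVneq l 0; first by rewrite mulr0 mulr_ge0.
  have lpos : 0 < l by rewrite lt_def ln0.
  rewrite -(ler_pM2l lpos).
  have := ler_wpM2l (ltW Lambda0) lU; have := ler_wpM2l s0 LU; lra.
have bound0 : 0 <= Num.sqrt #|S|%:R * m / Lambda.
  by rewrite divr_ge0 ?mulr_ge0 ?sqrtr_ge0// ltW.
rewrite -(@ler_pXn2r _ 2)// real_normK ?num_real// expr_div_n exprMn sqr_sqrtr//.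
rewrite ler_pdivlMr ?exprn_gt0//.
have uU : u k 0 ^+ 2 <= U.
  by rewrite /U (bigD1 k)//= lerDl sumr_ge0// => j _; exact: sqr_ge0.
have L2 := ler_wpM2l (exprn_ge0 2 (ltW Lambda0)) uU.
have H1 := ler_wpM2l (ltW Lambda0) LU; have H2 := ler_wpM2l m0 l_le.
rewrite mulrC; apply: le_trans L2 _; lra.
Qed.

(** The coefficients of column j of the design minus its least squares
    projection onto the columns in S. *)
Definition residual_coef (j : 'I_p) : 'cV[R]_p :=
  delta_mx j 0 - support_solve (gram X) (supp beta) (col j (gram X)).

Let c j := support_solve A S (col j A).

Let gram_sym : A^T = A.
Proof. by rewrite /A /gram linearZ/= trmx_mul trmxK. Qed.

Let mulmx_delta j : A *m (delta_mx j 0 : 'cV[R]_p) = col j A.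
Proof. by rewrite colE. Qed.

(* The normal equations of the least squares projection on the columns in S. *)
Let residual_orth j k : k \in S -> (A *m residual_coef j) k 0 = 0.
Proof.
move=> kS; rewrite mulmxBr mulmx_delta col_subE.
by rewrite (support_solve_in definite)// subrr.
Qed.

Let pythagoras j : A j j = quadform A (residual_coef j) + quadform A (c j).
Proof.
have E : (delta_mx j 0 : 'cV[R]_p) = residual_coef j + c j by rewrite subrK.
have cross : ((c j)^T *m A *m residual_coef j) 0 0 = 0.
  rewrite -mulmxA linear_form_sum big1// => k _.
  have [kS|kS] := boolP (k \in S); first by rewrite residual_orth// mulr0.
  by rewrite [c j k 0]support_solve_out ?mul0r//; exact: definite.
have cross' : ((residual_coef j)^T *m A *m c j) 0 0 = 0.
  rewrite -cross.
  have -> : (residual_coef j)^T *m A *m c j = ((c j)^T *m A *m residual_coef j)^T.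
    by rewrite !trmx_mul trmxK gram_sym mulmxA.
  by rewrite mxE.
have trD (x y : 'cV[R]_p) : (x + y)^T = x^T + y^T.
  by apply/matrixP => a b; rewrite !mxE.
have addE (M N : 'M[R]_1) : (M + N) 0 0 = M 0 0 + N 0 0 by rewrite mxE.
rewrite -bilinear_delta; move: E cross cross'.
move: (residual_coef j) (c j) => r q E cross cross'.
rewrite E trD !mulmxDl !mulmxDr !addE.
by rewrite cross cross' /quadform; ring.
Qed.

(** The residual of a projection is no longer than the projected column. *)
Lemma quadform_residual_le j : quadform (gram X) (residual_coef j) <= gram X j j.
Proof. by rewrite [leRHS]pythagoras lerDl quadform_gram_ge0. Qed.

(* The regression coefficients have squared l2 norm at most A_jj / Lambda. *)
Let projection_l1 j : 0 <= A j j ->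
  \sum_(k in S) `|c j k 0| <= Num.sqrt #|S|%:R * Num.sqrt (A j j / Lambda).
Proof.
move=> Ajj; have s0 : (0 : R) <= #|S|%:R by exact: ler0n.
have cS k : k \notin S -> c j k 0 = 0 by move=> kS; exact: support_solve_out.
rewrite -(@ler_pXn2r _ 2) ?nnegrE ?mulr_ge0 ?sqrtr_ge0 ?sumr_ge0//.
rewrite exprMn !sqr_sqrtr// ?divr_ge0 ?(ltW Lambda0)//.
apply: le_trans (sqr_sum_le _ _) _; apply: ler_wpM2l => //.
rewrite ler_pdivlMr// mulrC.
apply: (@le_trans _ _ (Lambda * \sum_k c j k 0 ^+ 2)).
  apply: ler_wpM2l; first exact: ltW.
  rewrite [leRHS](sum_setC S) [X in _ <= _ + X]big1 ?addr0.
    by apply: ler_sum => k _; rewrite real_normK ?num_real.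
  by move=> k; rewrite inE => /cS ->; rewrite expr0n.
apply: le_trans (sparse_bound cS) _.
by rewrite pythagoras lerDr quadform_gram_ge0.
Qed.

Variables (lambda zmax W : R) (w : 'I_p -> \bar R) (b : 'cV[R]_p).
Hypotheses (lambda0 : 0 <= lambda) (zmax0 : 0 <= zmax) (W0 : 0 <= W)
  (z_le : forall k, `|z k 0| <= zmax)
  (w0 : forall k, 0 <= fine (w k))
  (wS : forall k, k \in S -> (w k != +oo)%E /\ fine (w k) <= W)
  (signal : forall k, k \in S ->
    Num.sqrt #|S|%:R * (zmax + lambda * W) / Lambda < `|beta k 0|)
  (incoherence : forall j, j \notin S -> (w j != +oo)%E ->
    `|\sum_k residual_coef j k 0 * z k 0| +
      lambda * W * (Num.sqrt #|S|%:R * Num.sqrt (gram X j j / Lambda)) <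
    lambda * fine (w j))
  (adaptive : is_adaptive_lasso X Y lambda w b).

Let penalty : 'cV[R]_p := \col_k (lambda * fine (w k) * Num.sg (beta k 0)).
Let u := support_solve A S (z - penalty).
Let bt := beta + u.

Let penalty_le k : `|penalty k 0| <= lambda * fine (w k).
Proof.
rewrite mxE normrM ger0_norm ?mulr_ge0// ler_piMr ?mulr_ge0//.
by rewrite normr_sg lern1; case: (_ != _).
Qed.

Let penalty_S k : k \in S -> `|penalty k 0| <= lambda * W.
Proof.
by move=> kS; apply: le_trans (penalty_le k) _; rewrite ler_wpM2l// (wS kS).2.
Qed.

Let out k : k \notin S -> u k 0 = 0.
Proof. by move=> kS; exact: support_solve_out. Qed.

Let scoreE : score X Y bt = z - A *m u.
Proof.
rewrite /bt /score (mulmxDr X beta u) opprD addrA (mulmxBr X^T (Y - _)) scalerBr.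
by rewrite mulmxA /A /gram -scalemxAl.
Qed.

Let scoreS k : k \in S -> score X Y bt k 0 = penalty k 0.
Proof.
move=> kS; rewrite scoreE col_subE (support_solve_in definite)// col_subE.
by rewrite subKr.
Qed.

Let u_small k : k \in S -> `|u k 0| < `|beta k 0|.
Proof.
move=> kS; apply: le_lt_trans (signal kS); apply: support_solve_le.
  move=> j jS; rewrite col_subE; apply: le_trans (ler_normB _ _) _.
  by apply: lerD; [exact: z_le|exact: penalty_S].
by rewrite addr_ge0// mulr_ge0.
Qed.

Let bt_sg k : k \in S -> Num.sg (bt k 0) = Num.sg (beta k 0) /\ bt k 0 != 0.
Proof.
move=> /u_small; rewrite /bt [(beta + u) k 0]mxE; set x := beta k 0; set y := u k 0.
have [x0|x0|->] := ltrgtP x 0; last by rewrite normr0 normr_lt0.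
- rewrite (ltr0_norm x0) ltr_norml => /andP[H1 H2].
  have xy : x + y < 0 by lra.
  by rewrite !ltr0_sg// lt_eqF.
- rewrite (gtr0_norm x0) ltr_norml => /andP[H1 H2].
  have xy : 0 < x + y by lra.
  by rewrite !gtr0_sg// gt_eqF.
Qed.

(* Move the operator A from u to the regression coefficients c j by symmetry. *)
Let score_out j : j \notin S -> score X Y bt j 0 =
  \sum_k residual_coef j k 0 * z k 0 + \sum_(k in S) c j k 0 * penalty k 0.
Proof.
move=> jS.
have cS k : k \notin S -> c j k 0 = 0 by move=> kS; exact: support_solve_out.
have on_S (f g : 'I_p -> R) : (forall k, k \notin S -> f k = 0) ->
    \sum_k f k * g k = \sum_(k in S) f k * g k.
  move=> f0; rewrite (sum_setC S) [X in _ + X]big1 ?addr0// => k.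
  by rewrite inE => /f0 ->; rewrite mul0r.
have bilinear_sym (x y : 'cV[R]_p) :
    \sum_k x k 0 * (A *m y) k 0 = \sum_k y k 0 * (A *m x) k 0.
  rewrite -!linear_form_sum -[LHS]mulr1 -[RHS]mulr1.
  have -> : (x^T *m (A *m y)) = (y^T *m (A *m x))^T.
    by rewrite !trmx_mul trmxK gram_sym mulmxA.
  by rewrite mxE.
have deltaE k : (delta_mx j 0 : 'cV[R]_p) k 0 = (k == j)%:R by rewrite mxE andbT.
have Au : (A *m u) j 0 = \sum_(k in S) c j k 0 * (z - penalty) k 0.
  have -> : (A *m u) j 0 = \sum_k u k 0 * (A *m (delta_mx j 0 : 'cV[R]_p)) k 0.
    rewrite -bilinear_sym (bigD1 j)//= deltaE eqxx mul1r big1 ?addr0// => k kj.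
    by rewrite deltaE (negbTE kj) mul0r.
  transitivity (\sum_k u k 0 * (A *m c j) k 0).
    rewrite [LHS]on_S// [RHS]on_S//; apply: eq_bigr => k kS.
    by rewrite mulmx_delta (support_solve_in definite _ kS).
  rewrite bilinear_sym on_S//.
  by apply: eq_bigr => k kS; rewrite support_solve_in.
rewrite scoreE col_subE Au.
have -> : \sum_k residual_coef j k 0 * z k 0 =
    z j 0 - \sum_(k in S) c j k 0 * z k 0.
  rewrite -on_S//; transitivity (\sum_k ((k == j)%:R * z k 0 - c j k 0 * z k 0)).
    apply: eq_bigr => k _; by rewrite -mulrBl -deltaE -col_subE.
  rewrite sumrB; congr (_ - _).
  rewrite (bigD1 j)//= eqxx mul1r big1 ?addr0// => k kj.
  by rewrite (negbTE kj) mul0r.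
have -> : \sum_(k in S) c j k 0 * (z - penalty) k 0 =
    \sum_(k in S) c j k 0 * z k 0 - \sum_(k in S) c j k 0 * penalty k 0.
  rewrite -sumrB; apply: eq_bigr => k _.
  by rewrite col_subE mulrBr.
ring.
Qed.

(** The candidate is beta + u with u solving the stationarity equations on S.
    The signal condition keeps the signs of beta on S.  Outside S the score of
    the candidate is the projected noise plus the image of the penalty under
    the regression coefficients of column j on the columns in S, and the
    incoherence condition bounds both. *)
Theorem adaptive_lasso_support : supp b = supp beta.
Proof.
have bE : b = bt.
  apply: (adaptive_lasso_unique definite _ _ _ adaptive).
  - move=> k kS; have [wk _] := wS kS; split=> //.
    have [sgE _] := bt_sg kS; rewrite scoreS//; split=> //.
    by rewrite [penalty k 0]mxE -sgE -mulrA -normrEsg.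
  - move=> j jS; rewrite /bt mxE out// addr0.
    by move: jS; rewrite inE negbK => /eqP.
  - move=> j jS wj; apply: le_lt_trans (incoherence jS wj).
    rewrite score_out//; apply: le_trans (ler_normD _ _) _; rewrite lerD2l.
    apply: le_trans (ler_norm_sum _ _ _) _.
    apply: (@le_trans _ _ (lambda * W * \sum_(k in S) `|c j k 0|)).
      rewrite mulr_sumr; apply: ler_sum => k kS.
      by rewrite normrM mulrC ler_wpM2r// penalty_S.
    apply: ler_wpM2l; first by rewrite mulr_ge0.
    apply: projection_l1.
    by rewrite pythagoras addr_ge0 ?quadform_gram_ge0.
apply/setP => k; rewrite bE !inE; have [kS|kS] := boolP (k \in S).
  by have [_ ->] := bt_sg kS; move: kS; rewrite inE => ->.
by rewrite /bt mxE out// addr0.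
Qed.

End selection.

(** * Arithmetic of the tuning constants *)

(** Dictionary: ss = sqrt s, sb = sqrt sbar, L = sqrt Lambda_min(s),
    u = c0 sigma sqrt(2 ln (p - s) / n), r3 = sqrt 3, and B is the lower bound
    assumed for beta_min.  Then 3 x below is the bound for the coordinates of
    the error of the initial estimator, and W is a bound for the weights on
    the support, where the initial estimator is at least 15 B / 16. *)
Section tuning_arithmetic.
Context {R : realType}.
Variables (ss sb L K lambda lambda_n u M eta c0 r3 B : R).
Hypotheses (ss0 : 0 < ss) (L0 : 0 < L) (K_sqr : 2 <= K ^+ 2) (K0 : 0 < K)
  (lambda0 : 0 < lambda) (u0 : 0 < u) (eta01 : 0 < eta < 1)
  (c00 : 0 < c0) (c0_sqr : c0 ^+ 2 = 3 / 2) (r30 : 0 < r3) (r3_sqr : r3 ^+ 2 = 3)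
  (ss_sb : ss <= sb) (sb_ss : sb ^+ 2 <= ss ^+ 2 * (1 + 9 / 16 * K ^+ 2))
  (K_Lambda : 32 <= 17 * K ^+ 2 * L ^+ 2)
  (M_lower : 4 * K / eta <= M) (M_upper : M * u * (1 - eta) <= L)
  (u_lambda : 2 * r3 * u <= lambda)
  (lambda_n_lower : 64 * K ^+ 2 / eta * (u * lambda * sb) <= lambda_n)
  (lambda_n_upper : lambda_n <= 16 * M * K * (u * lambda * sb))
  (sparsity : 48 * K ^+ 2 * lambda * ss ^+ 2 <= c0 * L * (1 - eta))
  (B_incoherence : 32 * K ^+ 2 * lambda * ss ^+ 2 <= B * (1 - eta) * L)
  (B_M : 16 * M * K ^+ 2 * lambda * ss <= r3 * B).

Let x := K ^+ 2 * lambda * ss.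
Let x0 : 0 < x. Proof. by rewrite !mulr_gt0 ?exprn_gt0. Qed.
Let h0 : 0 < 1 - eta. Proof. by move: eta01; lra. Qed.
Let eta0 : 0 < eta. Proof. by move: eta01; lra. Qed.

Let M_K : 4 * K <= M.
Proof.
apply: le_trans M_lower; rewrite ler_pdivlMr// ler_piMr ?mulr_ge0 ?(ltW K0)//.
by move: eta01; lra.
Qed.

Let K_lower : 14 / 10 <= K.
Proof. by rewrite leNgt; apply/negP => H; move: K0 K_sqr; nra. Qed.

Let r3_upper : r3 <= 9 / 5.
Proof. by rewrite leNgt; apply/negP => H; move: r3_sqr; nra. Qed.

Let M0 : 0 < M. Proof. by move: M_K K0; lra. Qed.

Lemma signal_vs_init_error : 16 * (3 * x) <= B.
Proof.
have Bx : 89 * x <= r3 * B.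
  apply: le_trans (_ : 16 * M * x <= _).
    by rewrite ler_pM2r//; move: M_K K_lower; lra.
  by move: B_M; rewrite /x; lra.
have B0 : 0 < B by rewrite -(pmulr_rgt0 _ r30); apply: lt_le_trans Bx; move: x0; lra.
have : r3 * B <= 9 / 5 * B by rewrite ler_pM2r.
by move: x0; lra.
Qed.

Let B0 : 0 < B.
Proof. by apply: lt_le_trans signal_vs_init_error; move: x0; lra. Qed.

Let sb0 : 0 < sb. Proof. exact: lt_le_trans ss_sb. Qed.

(* 33/32 is a rational upper bound for the square root of 17/16. *)
Let sb_upper : sb <= 33 / 32 * (K * ss).
Proof.
have Kss : 0 < K * ss by rewrite mulr_gt0.
rewrite -(@ler_pXn2r _ 2) ?nnegrE ?(ltW sb0)//; last by rewrite mulr_ge0// ltW.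
apply: le_trans sb_ss _; rewrite !exprMn.
have : 0 <= ss ^+ 2 * (K ^+ 2 - 2) by rewrite mulr_ge0 ?sqr_ge0//; move: K_sqr; lra.
have : 0 < K ^+ 2 * ss ^+ 2 by rewrite mulr_gt0 ?exprn_gt0.
lra.
Qed.

Let lambda_n_M : lambda_n <= 33 / 2 * x * (M * u).
Proof.
apply: le_trans lambda_n_upper _.
have c : 0 <= 16 * M * K * (u * lambda) by rewrite !mulr_ge0 ?ltW.
by have := ler_wpM2l c sb_upper; rewrite /x; lra.
Qed.

Lemma lambda_n_gt0 : 0 < lambda_n.
Proof.
apply: lt_le_trans lambda_n_lower.
by rewrite !mulr_gt0 ?invr_gt0 ?exprn_gt0.
Qed.

Let W := Num.max (16 / (15 * B)) 1.

(* The next two bounds treat the two cases of the maximum W: the first uses the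
   upper bound on M, the second one the relation between u and lambda. *)
Let half1 : ss * lambda_n / L ^+ 2 <= 66 / 100 * B.
Proof.
rewrite ler_pdivrMr ?exprn_gt0// -(ler_pM2r h0).
have H1 : lambda_n * (1 - eta) <= 33 / 2 * x * L.
  apply: le_trans (ler_wpM2r (ltW h0) lambda_n_M) _.
  have c : 0 <= 33 / 2 * x by rewrite mulr_ge0 ?ltW.
  by have := ler_wpM2l c M_upper; lra.
have H2 := ler_wpM2l (ltW ss0) H1.
have H3 := ler_wpM2l (ltW L0) B_incoherence.
have : 0 < x * ss * L by rewrite !mulr_gt0.
by move: H2 H3; rewrite /x; lra.
Qed.

Let half2 : ss * lambda_n / L ^+ 2 * (16 / (15 * B)) <= 66 / 100 * B.
Proof.
have LK : (L ^+ 2)^-1 <= 17 / 32 * K ^+ 2.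
  by rewrite -[_^-1]mul1r ler_pdivrMr ?exprn_gt0//; move: K_Lambda; lra.
have H1 : 2 * r3 * lambda_n <= 33 / 2 * x * M * lambda.
  have r : 0 <= 2 * r3 by rewrite mulr_ge0 ?ltW.
  apply: le_trans (ler_wpM2l r lambda_n_M) _.
  have c : 0 <= 33 / 2 * x * M by rewrite !mulr_ge0 ?ltW.
  by have := ler_wpM2l c u_lambda; lra.
have H2 : ss * lambda_n / L ^+ 2 <= 17 / 32 * K ^+ 2 * ss * lambda_n.
  have c : 0 <= ss * lambda_n by rewrite mulr_ge0 ?ltW// lambda_n_gt0.
  by have := ler_wpM2l c LK; lra.
have H3 : 48 * x * (16 * M * x) <= B * (r3 * B).
  apply: ler_pM; [by rewrite mulr_ge0 ?ltW|by rewrite !mulr_ge0 ?ltW| |].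
    by have := signal_vs_init_error; lra.
  by move: B_M; rewrite /x; lra.
have H4 : 2 * r3 * (ss * lambda_n / L ^+ 2) <= 9 * (x * x * M).
  have c : 0 <= 2 * r3 by rewrite mulr_ge0 ?ltW.
  apply: le_trans (ler_wpM2l c H2) _.
  have c' : 0 <= 17 / 32 * K ^+ 2 * ss by rewrite !mulr_ge0 ?exprn_ge0 ?ltW.
  have := ler_wpM2l c' H1.
  have : 0 <= x * x * M by rewrite !mulr_ge0 ?ltW.
  by rewrite /x; lra.
have H5 : ss * lambda_n / L ^+ 2 <= B * B / 2.
  rewrite -(ler_pM2l r30); move: H3 H4.
  have : 0 <= x * x * M by rewrite !mulr_ge0 ?ltW.
  lra.
have B15 : 0 < 15 * B by rewrite mulr_gt0.
rewrite mulrA ler_pdivrMr//.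
have : 0 <= B * B by rewrite mulr_ge0 ?ltW.
lra.
Qed.

Lemma signal_arith : ss * (lambda / 2 + lambda_n * W) / L ^+ 2 < B.
Proof.
have LK : (L ^+ 2)^-1 <= 17 / 32 * K ^+ 2.
  by rewrite -[_^-1]mul1r ler_pdivrMr ?exprn_gt0//; move: K_Lambda; lra.
have noise : ss * (lambda / 2) / L ^+ 2 <= B / 100.
  have c : 0 <= ss * (lambda / 2) by rewrite mulr_ge0 ?divr_ge0 ?ltW.
  apply: le_trans (ler_wpM2l c LK) _.
  by have := signal_vs_init_error; move: x0; rewrite /x; lra.
have pen : ss * lambda_n / L ^+ 2 * W <= 66 / 100 * B.
  rewrite /W /Order.max; case: ifP => _; first by rewrite mulr1.
  exact: half2.
have -> : ss * (lambda / 2 + lambda_n * W) / L ^+ 2 =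
  ss * (lambda / 2) / L ^+ 2 + ss * lambda_n / L ^+ 2 * W by ring.
by move: noise pen B0; lra.
Qed.

Lemma incoherence_arith : 3 * x * W * ss * (c0 / L) <= 1 / 8.
Proof.
have c0_upper : c0 <= 5 / 4.
  by rewrite leNgt; apply/negP => H; move: c0_sqr; nra.
rewrite mulrA ler_pdivrMr// /W /Order.max; case: ifP => _.
  have H := ler_wpM2r (ltW c00) sparsity.
  have Lh : 0 <= L * eta by rewrite mulr_ge0 ?ltW.
  have -> : 3 * x * 1 * ss * c0 = 48 * K ^+ 2 * lambda * ss ^+ 2 * c0 / 16.
    by rewrite /x; field.
  have E : c0 * L * (1 - eta) * c0 = c0 ^+ 2 * (L * (1 - eta)) by ring.
  move: H L0; rewrite E c0_sqr; lra.
have -> : 3 * x * (16 / (15 * B)) * ss * c0 = 48 * x * ss * c0 / (15 * B).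
  by field; exact: lt0r_neq0.
rewrite ler_pdivrMr ?mulr_gt0//.
have y0 : 0 <= x * ss by rewrite mulr_ge0 ?ltW.
have H1 := ler_wpM2l y0 c0_upper.
have BL : 0 <= B * L * eta by rewrite !mulr_ge0 ?ltW.
by move: B_incoherence H1; rewrite /x; lra.
Qed.

Lemma noise_arith : 3 * u * (3 * x) <= 9 / 64 * lambda_n.
Proof.
have H : 64 * K ^+ 2 * (u * lambda * ss) <= lambda_n.
  apply: le_trans lambda_n_lower.
  apply: ler_pM; [by rewrite mulr_ge0 ?exprn_ge0 ?ltW|by rewrite !mulr_ge0 ?ltW| |].
    by rewrite ler_pMr ?mulr_gt0 ?exprn_gt0// invf_ge1//; move: eta01; lra.
  by rewrite ler_pM2l ?mulr_gt0.
move: H; rewrite /x; lra.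
Qed.

End tuning_arithmetic.

Section sizes.
Context {R : realType}.
Variables (n p s : nat) (C2 : R).
Hypotheses (s_gt0 : (1 <= s)%N) (s_half : (2 * s <= p)%N) (n_le_p : (n <= p)%N)
  (p_lt : p%:R < expR (n%:R / (4 * C2 ^+ 2)))
  (C2_gt : 4 * Num.sqrt (5 / 3) < C2).

Let p_ge2 : (2 <= p)%N. Proof. by lia. Qed.
Let p_gt0 : (0 : R) < p%:R. Proof. by rewrite ltr0n; lia. Qed.

Lemma C2_gt0 : 0 < C2.
Proof. by apply: le_lt_trans C2_gt; rewrite mulr_ge0 ?sqrtr_ge0. Qed.

Lemma C2_sqr_gt : 80 / 3 < C2 ^+ 2.
Proof.
have -> : 80 / 3 = (4 * Num.sqrt (5 / 3)) ^+ 2 :> R.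
  by rewrite exprMn sqr_sqrtr ?divr_ge0//; field.
by rewrite ltr_pXn2r// nnegrE ?mulr_ge0 ?sqrtr_ge0// ltW ?C2_gt0.
Qed.

Lemma ln_p_lt : 4 * C2 ^+ 2 * ln p%:R < n%:R.
Proof.
have c : 0 < 4 * C2 ^+ 2 by rewrite mulr_gt0 ?exprn_gt0 ?C2_gt0.
by rewrite mulrC -ltr_pdivlMr// -ltr_expR lnK ?posrE.
Qed.

Let p_ge_ln : 320 / 3 * ln p%:R < p%:R :> R.
Proof.
have l0 : 0 <= ln p%:R :> R by rewrite ln_ge0// ler1n; lia.
have := ln_p_lt; have := ler_wpM2r l0 (ltW C2_sqr_gt).
have : n%:R <= p%:R :> R by rewrite ler_nat.
lra.
Qed.

Let ln2 : 1 / 2 <= ln 2 :> R.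
Proof.
rewrite -ler_expR lnK ?posrE//.
have H : 1 / 2 <= expR (- (1 / 2)) :> R.
  by apply: le_trans (expR_ge1Dx _); lra.
have E := expRN (1 / 2 : R); rewrite E in H.
have e0 : 0 < expR (1 / 2) :> R by exact: expR_gt0.
have := ler_wpM2r (ltW e0) H; rewrite mulVf ?gt_eqF//; lra.
Qed.

(** A bootstrap: ln p >= ln 2 >= 1/2 gives p > (320/3) (1/2) >= 16, hence
    ln p >= 4 ln 2 >= 2. *)
Lemma ln_p_ge2 : 2 <= ln p%:R :> R.
Proof.
have H : 1 / 2 <= ln p%:R :> R.
  by apply: le_trans ln2 _; rewrite ler_ln ?posrE// ler_nat.
have p16 : 2 ^+ 4 <= p%:R :> R.
  have -> : 2 ^+ 4 = 16 :> R by ring.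
  by move: p_ge_ln H; lra.
have : ln (2 ^+ 4) <= ln p%:R :> R by rewrite ler_ln ?posrE ?exprn_gt0.
by rewrite lnXn//; move: ln2; lra.
Qed.

Lemma dimension_ge213 : 213 <= p%:R :> R.
Proof. by have := p_ge_ln; have := ln_p_ge2; lra. Qed.

Lemma sample_size_gt0 : (0 < n)%N.
Proof.
rewrite -(ltr0n R); apply: le_lt_trans ln_p_lt; have := ln_p_ge2.
move=> H; have l0 : 0 <= ln p%:R :> R by apply: le_trans H.
by apply: mulr_ge0 => //; apply: mulr_ge0 => //; exact: sqr_ge0.
Qed.

(** By p - s >= p / 2 and (p / 2)^2 >= p. *)
Lemma ln_p_sub_s : ln p%:R <= 2 * ln (p - s)%:R :> R.
Proof.
have ps : p%:R / 2 <= (p - s)%:R :> R.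
  rewrite ler_pdivrMr// -natrM ler_nat; lia.
have p0 := dimension_ge213.
have ps0 : (0 : R) < (p - s)%:R by lra.
have -> : 2 * ln (p - s)%:R = ln ((p - s)%:R ^+ 2) :> R.
  by rewrite lnXn// mulr_natl.
rewrite ler_ln ?posrE ?exprn_gt0//; nra.
Qed.

End sizes.

(** * The deterministic argument on a good sample *)

Lemma lt_of_double_le (s p : nat) : (0 < s)%N -> (2 * s <= p)%N -> (s < p)%N.
Proof. by lia. Qed.

Lemma le_sub_of_double_le (s p : nat) : (2 * s <= p)%N -> (s <= p - s)%N.
Proof. by lia. Qed.

Lemma sqrt_sqr_mul (R : realType) (a b : R) : 0 <= a ->
  Num.sqrt (a ^+ 2 * b) = a * Num.sqrt b.
Proof. by move=> a0; rewrite sqrtrM ?sqr_ge0// sqrtr_sqr ger0_norm. Qed.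

Section good_sample.
Context {R : realType} {n p : nat}.
Variables (beta : 'cV[R]_p) (Sigma : 'M[R]_p) (sigma C2 : R) (s : nat)
  (K c0 lambda_init eta M : R).
Hypotheses (sigma_gt0 : 0 < sigma) (psd : is_psd Sigma)
  (n_le_p : (n <= p)%N) (p_lt : p%:R < expR (n%:R / (4 * C2 ^+ 2)))
  (C2_gt : 4 * Num.sqrt (5 / 3) < C2) (s_def : s = #|supp beta|)
  (RE : RE_assumption (supp beta) s s 3 Sigma)
  (K_def : K = Num.sqrt 2 * RE_K s s 3 Sigma) (c0_def : c0 = Num.sqrt (3 / 2))
  (lambda_init_def :
    lambda_init = Num.sqrt 24 * c0 * sigma * Num.sqrt (ln p%:R / n%:R))
  (eta_bounds : 0 < eta < 1)
  (M_bounds : 4 * K / eta <= M <=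
    Num.sqrt (Lambda_min Sigma s) / ((1 - eta) * c0 * sigma)
      * Num.sqrt (n%:R / (2 * ln p%:R)))
  (s_le : s%:R <= 1 / (32 * RE_K s s 3 Sigma ^+ 2)
    * Num.min (1 / C2)
        (Num.sqrt (Lambda_min Sigma s) * (1 - eta) / (6 * Num.sqrt 6 * sigma))
    * Num.sqrt (n%:R / ln p%:R))
  (beta_min_gt :
    Num.max (2 * Num.sqrt s%:R / ((1 - eta) * Num.sqrt (Lambda_min Sigma s)))
            (M / Num.sqrt 3)
      * 16 * K ^+ 2 * lambda_init * Num.sqrt s%:R < beta_min beta).

Variables (X : 'M[R]_(n, p)) (Y : 'cV[R]_n) (lambda_n : R) (sbar : nat)
  (binit b : 'cV[R]_p).
Hypotheses (init : is_lasso X Y lambda_init binit)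
  (sbar_def : sbar = #|[set j | (4 * lambda_init < `|binit j 0|)%R]%SET|)
  (lambda_n_bounds : 64 * K ^+ 2 / eta <=
      lambda_n / (c0 * sigma * lambda_init * Num.sqrt sbar%:R)
        * Num.sqrt (n%:R / (2 * ln (p - s)%:R)) <= 16 * M * K)
  (adaptive : is_adaptive_lasso X Y lambda_n (ada_weight binit) b).
Hypotheses
  (gram_close : forall j k, `|gram X j k - Sigma j k| <=
    4 * Num.sqrt (5 / 3) * Num.sqrt (ln p%:R / n%:R))
  (score_small : forall j, `|score X Y beta j 0| <=
    c0 * sigma * Num.sqrt (6 * ln p%:R / n%:R))
  (residual_small : forall j, j \notin supp beta ->
    `|\sum_k residual_coef X beta j k 0 * score X Y beta k 0| <=
    c0 * sigma * Num.sqrt (8 * ln p%:R / n%:R)).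

Let S := supp beta.
Let kappa := RE_invK s s 3 Sigma.
Let Lambda := Lambda_min Sigma s.
Let L := Num.sqrt Lambda.
Let rho := Num.sqrt (ln p%:R / n%:R) : R.
Let r1 := Num.sqrt (2 * ln (p - s)%:R / n%:R) : R.
Let cs := c0 * sigma.
Let ss := Num.sqrt s%:R : R.
Let sb := Num.sqrt sbar%:R : R.
Let t := 4 * Num.sqrt (5 / 3) * rho.
Let B := Num.max (2 * ss / ((1 - eta) * L)) (M / Num.sqrt 3)
      * 16 * K ^+ 2 * lambda_init * ss.

Let s_gt0 : (0 < s)%N. Proof. exact: RE_s_gt0 RE. Qed.
Let s_half : (2 * s <= p)%N. Proof. exact: RE_s_half RE. Qed.

Let lnp2 : 2 <= ln p%:R :> R.
Proof. exact: (ln_p_ge2 s_gt0 s_half n_le_p p_lt C2_gt). Qed.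

Let n0 : (0 : R) < n%:R.
Proof. by rewrite ltr0n (sample_size_gt0 s_gt0 s_half n_le_p p_lt C2_gt). Qed.

Let ln_n0 : 0 < ln p%:R / n%:R :> R.
Proof. by rewrite divr_gt0//; move: lnp2; lra. Qed.

Let rho0 : 0 < rho. Proof. by rewrite sqrtr_gt0. Qed.

Let ln_ps : ln p%:R <= 2 * ln (p - s)%:R :> R.
Proof. exact: (ln_p_sub_s s_gt0 s_half n_le_p p_lt C2_gt). Qed.

Let rho_r1 : rho <= r1.
Proof. by rewrite ler_wsqrtr// ler_pM2r ?invr_gt0. Qed.

Let r1_0 : 0 < r1. Proof. exact: lt_le_trans rho_r1. Qed.

Let r1_rho : r1 <= Num.sqrt 2 * rho.
Proof.
rewrite -sqrtrM// mulrA ler_wsqrtr// ler_pM2r ?invr_gt0// ler_pM2l//.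
have s_p := lt_of_double_le s_gt0 s_half.
by rewrite ler_ln ?posrE ?ltr0n ?ler_nat ?leq_subr ?subn_gt0// (ltn_trans s_gt0).
Qed.

Let c0_0 : 0 < c0. Proof. by rewrite c0_def sqrtr_gt0 divr_gt0. Qed.
Let c0_sqr : c0 ^+ 2 = 3 / 2. Proof. by rewrite c0_def sqr_sqrtr ?divr_ge0. Qed.
Let cs0 : 0 < cs. Proof. by rewrite mulr_gt0. Qed.
Let lambda_init0 : 0 < lambda_init.
Proof. by rewrite lambda_init_def !mulr_gt0// sqrtr_gt0. Qed.
Let kappa0 : 0 < kappa. Proof. exact: RE_invK_gt0 RE. Qed.
Let kappa1 : kappa <= 1. Proof. exact: RE_invK_le1 RE. Qed.

Let K_sqr : K ^+ 2 = 2 / kappa ^+ 2.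
Proof. by rewrite K_def /RE_K exprMn sqr_sqrtr// exprVn. Qed.

Let K0 : 0 < K. Proof. by rewrite K_def mulr_gt0 ?sqrtr_gt0 ?invr_gt0. Qed.

Let K_sqr_ge2 : 2 <= K ^+ 2.
Proof. by rewrite K_sqr ler_peMr// invf_ge1 ?exprn_gt0// exprn_ile1// ltW. Qed.

Let Lambda0 : 0 < Lambda.
Proof.
have : 0 < 17 * Lambda_min Sigma s / 16 := RE_Lambda_gt0 RE.
by rewrite /Lambda; lra.
Qed.

Let L0 : 0 < L. Proof. by rewrite sqrtr_gt0. Qed.
Let L_sqr : L ^+ 2 = Lambda. Proof. by rewrite sqr_sqrtr// ltW. Qed.

Let K_Lambda : 32 <= 17 * K ^+ 2 * L ^+ 2.
Proof.
have := RE_invK_sqr_le_Lambda_min RE; rewrite -/kappa -/Lambda => H.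
rewrite K_sqr L_sqr; have k2 : 0 < kappa ^+ 2 by rewrite exprn_gt0.
have -> : 17 * (2 / kappa ^+ 2) * Lambda = 34 * Lambda / kappa ^+ 2.
  by field; exact: lt0r_neq0.
by rewrite ler_pdivlMr//; lra.
Qed.

Let s0 : (0 : R) < s%:R. Proof. by rewrite ltr0n. Qed.
Let ss0 : 0 < ss. Proof. by rewrite sqrtr_gt0. Qed.
Let ss_sqr : ss ^+ 2 = s%:R. Proof. by rewrite sqr_sqrtr// ltW. Qed.
Let h0 : 0 < 1 - eta. Proof. by move: eta_bounds; lra. Qed.
Let C20 : 0 < C2. Proof. exact: C2_gt0 C2_gt. Qed.

Let s_rho (m : R) : Num.min (1 / C2)
        (L * (1 - eta) / (6 * Num.sqrt 6 * sigma)) <= m ->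
  s%:R * rho <= kappa ^+ 2 / 32 * m.
Proof.
move=> Hm; have := s_le; rewrite -/L.
have -> : 1 / (32 * RE_K s s 3 Sigma ^+ 2) = kappa ^+ 2 / 32.
  by rewrite /RE_K -/kappa; field; exact: lt0r_neq0.
have -> : Num.sqrt (n%:R / ln p%:R) = rho^-1 :> R.
  by rewrite /rho -sqrtrV ?ltW// invf_div.
rewrite ler_pdivlMr// => H; apply: le_trans H _.
by apply: ler_wpM2l => //; rewrite divr_ge0// exprn_ge0// ltW.
Qed.

(** Combine the first bound on s with C2 > 4 sqrt(5/3). *)
Lemma sparsity_deviation : s%:R * t <= kappa ^+ 2 / 32.
Proof.
have H : s%:R * rho <= kappa ^+ 2 / 32 * (1 / C2) by apply: s_rho; rewrite ge_min lexx.
have sr0 : 0 <= s%:R * rho by rewrite mulr_ge0 ?ltW.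
have -> : s%:R * t = 4 * Num.sqrt (5 / 3) * (s%:R * rho) by rewrite /t; ring.
apply: le_trans (ler_wpM2r sr0 (ltW C2_gt)) _.
by move: H; rewrite mulrA mulr1 ler_pdivlMr// mulrC.
Qed.

Let sparsity : 48 * K ^+ 2 * lambda_init * ss ^+ 2 <= c0 * L * (1 - eta).
Proof.
have H : s%:R * rho <= kappa ^+ 2 / 32 * (L * (1 - eta) / (6 * Num.sqrt 6 * sigma)).
  by apply: s_rho; rewrite ge_min lexx orbT.
rewrite ss_sqr lambda_init_def K_sqr -/rho.
have -> : Num.sqrt 24 = 2 * Num.sqrt 6 :> R.
  by rewrite -sqrt_sqr_mul//; congr Num.sqrt; ring.
have q0 : 0 < Num.sqrt 6 :> R by rewrite sqrtr_gt0.
set q := Num.sqrt 6 in q0 H *.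
have c : 0 <= 48 * (2 / kappa ^+ 2) * (2 * q * c0 * sigma).
  by rewrite !mulr_ge0 ?invr_ge0 ?exprn_ge0 ?ltW.
have := ler_wpM2l c H.
have -> : 48 * (2 / kappa ^+ 2) * (2 * q * c0 * sigma) *
    (kappa ^+ 2 / 32 * (L * (1 - eta) / (6 * q * sigma))) = c0 * L * (1 - eta).
  by field; rewrite !lt0r_neq0.
by rewrite [_ * (s%:R * rho)](_ : _ =
  48 * (2 / kappa ^+ 2) * (2 * q * c0 * sigma * rho) * s%:R); last by ring.
Qed.

Let u := cs * r1.
Let u0 : 0 < u. Proof. by rewrite mulr_gt0. Qed.

Let u_rho : u <= cs * (Num.sqrt 2 * rho).
Proof. by rewrite ler_pM2l. Qed.

Let u_lambda : 2 * Num.sqrt 3 * u <= lambda_init.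
Proof.
have r3 : 0 < 2 * Num.sqrt 3 :> R by rewrite mulr_gt0 ?sqrtr_gt0.
have H := ler_wpM2l (ltW r3) u_rho; apply: le_trans H _.
rewrite lambda_init_def -/rho.
have -> : Num.sqrt 24 = 2 * Num.sqrt 3 * Num.sqrt 2 :> R.
  by rewrite -mulrA -sqrtrM// -sqrt_sqr_mul//; congr Num.sqrt; ring.
by rewrite le_eqVlt; apply/orP; left; apply/eqP; rewrite /cs; ring.
Qed.

Let M_lower : 4 * K / eta <= M. Proof. by have /andP[] := M_bounds. Qed.

Let M0 : 0 < M.
Proof.
apply: lt_le_trans M_lower; have /andP[e0 _] := eta_bounds.
by rewrite divr_gt0// mulr_gt0.
Qed.

Let M_upper : M * u * (1 - eta) <= L.
Proof.
have /andP[_] := M_bounds; rewrite -/Lambda -/L.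
have r2 : 0 < Num.sqrt 2 * rho by rewrite mulr_gt0 ?sqrtr_gt0.
have -> : Num.sqrt (n%:R / (2 * ln p%:R)) = (Num.sqrt 2 * rho)^-1 :> R.
  have q0 : 0 <= 2 * (ln p%:R / n%:R) :> R by rewrite mulr_ge0// ltW.
  by rewrite /rho -sqrtrM// -sqrtrV// mulrA invf_div.
have -> : L / ((1 - eta) * c0 * sigma) * (Num.sqrt 2 * rho)^-1 =
    L / ((1 - eta) * (cs * (Num.sqrt 2 * rho))).
  rewrite /cs; field.
  rewrite !lt0r_neq0 ?sqrtr_gt0//.
have d0 : 0 < (1 - eta) * (cs * (Num.sqrt 2 * rho)) by rewrite !mulr_gt0 ?sqrtr_gt0.
rewrite ler_pdivlMr// => H; apply: le_trans H.
have c : 0 <= M * (1 - eta) by rewrite mulr_ge0 ?ltW.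
by have := ler_wpM2l c u_rho; lra.
Qed.

Let max_factor0 : 0 <= 16 * K ^+ 2 * lambda_init * ss.
Proof. by rewrite !mulr_ge0 ?exprn_ge0 ?ltW. Qed.

Let B_incoherence : 32 * K ^+ 2 * lambda_init * ss ^+ 2 <= B * (1 - eta) * L.
Proof.
have hL : 0 < (1 - eta) * L by rewrite mulr_gt0.
rewrite -[leRHS]mulrA -ler_pdivrMr//.
apply: le_trans (_ : _ <= 2 * ss / ((1 - eta) * L) * (16 * K ^+ 2 * lambda_init * ss)) _.
  by rewrite le_eqVlt; apply/orP; left; apply/eqP; field; rewrite !lt0r_neq0.
rewrite /B [leRHS](_ : _ = Num.max (2 * ss / ((1 - eta) * L)) (M / Num.sqrt 3) *
  (16 * K ^+ 2 * lambda_init * ss)); last by ring.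
by apply: ler_wpM2r => //; rewrite le_max lexx.
Qed.

Let B_M : 16 * M * K ^+ 2 * lambda_init * ss <= Num.sqrt 3 * B.
Proof.
have r3 : 0 < Num.sqrt 3 :> R by rewrite sqrtr_gt0.
rewrite [leRHS]mulrC -ler_pdivrMr//.
apply: le_trans (_ : _ <= M / Num.sqrt 3 * (16 * K ^+ 2 * lambda_init * ss)) _.
  by rewrite le_eqVlt; apply/orP; left; apply/eqP; field; rewrite lt0r_neq0.
rewrite /B [leRHS](_ : _ = Num.max (2 * ss / ((1 - eta) * L)) (M / Num.sqrt 3) *
  (16 * K ^+ 2 * lambda_init * ss)); last by ring.
by apply: ler_wpM2r => //; rewrite le_max lexx orbT.
Qed.

Let beta_large k : k \in S -> B < `|beta k 0|.
Proof.
move=> kS; apply: lt_le_trans beta_min_gt _; apply: ge_inf.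
  by exists 0 => _ [j _ <-].
by exists k.
Qed.

Lemma deviation_le_half : t <= 1 / 2.
Proof.
have t0 : 0 <= t by rewrite !mulr_ge0 ?sqrtr_ge0.
rewrite -(@ler_pXn2r _ 2) ?nnegrE//.
have -> : t ^+ 2 = 80 / 3 * (ln p%:R / n%:R).
  have r2 : rho ^+ 2 = ln p%:R / n%:R by rewrite sqr_sqrtr// ltW.
  have q2 : Num.sqrt (5 / 3) ^+ 2 = 5 / 3 :> R by rewrite sqr_sqrtr// divr_ge0.
  by rewrite -r2 /t !exprMn q2; field.
have H1 : 4 * C2 ^+ 2 * ln p%:R < n%:R :> R := ln_p_lt s_gt0 s_half n_le_p p_lt C2_gt.
have l0 : 0 <= ln p%:R :> R by move: lnp2; lra.
have H2 := ler_wpM2r l0 (ltW (C2_sqr_gt C2_gt)).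
by rewrite mulrA ler_pdivrMr//; lra.
Qed.

Let t0 : 0 <= t. Proof. by rewrite !mulr_ge0 ?sqrtr_ge0. Qed.

Let sparse_bound (g : 'cV[R]_p) : (forall j, j \notin S -> g j 0 = 0) ->
  Lambda * \sum_j g j 0 ^+ 2 <= quadform (gram X) g.
Proof.
move=> gS; apply: (gram_sparse_bound psd RE t0 gram_close sparsity_deviation) => //.
by rewrite s_def.
Qed.

Let gram_diag j : gram X j j <= 3 / 2.
Proof.
have := gram_close j j; rewrite (RE_diag RE) -/rho -/t ler_norml.
by move: deviation_le_half; lra.
Qed.

Let score_lambda j : `|score X Y beta j 0| <= lambda_init / 2.
Proof.
apply: le_trans (score_small j) _.
rewrite le_eqVlt; apply/orP; left; apply/eqP.
have -> : Num.sqrt (6 * ln p%:R / n%:R) = Num.sqrt 6 * rho by rewrite -mulrA sqrtrM.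
rewrite lambda_init_def -/rho.
have -> : Num.sqrt 24 = 2 * Num.sqrt 6 :> R.
  by rewrite -sqrt_sqr_mul//; congr Num.sqrt; ring.
by field.
Qed.

Let K2_0 : 0 < K ^+ 2. Proof. by rewrite exprn_gt0. Qed.

Let betaS j : j \notin S -> beta j 0 = 0.
Proof. by rewrite inE negbK => /eqP. Qed.

Let cone_bound (Jm : {set 'I_p}) (g : 'cV[R]_p) :
  \sum_(j in ~: S) `|g j 0| <= 3 * \sum_(j in S) `|g j 0| ->
  m_largest_outside s S g Jm ->
  \sum_(j in S :|: Jm) g j 0 ^+ 2 <= K ^+ 2 * quadform (gram X) g.
Proof.
move=> cone HJm.
have Ss : (#|S| <= s)%N by rewrite s_def.
have := gram_RE RE t0 gram_close sparsity_deviation Ss cone HJm.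
rewrite -/kappa K_sqr => H; have k2 : 0 < 2 / kappa ^+ 2 by rewrite divr_gt0 ?exprn_gt0.
have := ler_wpM2l (ltW k2) H.
by rewrite mulrA [_ * (kappa ^+ 2 / 2)](_ : _ = 1) ?mul1r//; field; exact: lt0r_neq0.
Qed.

Let s_le_compl : (s <= #|~: S|)%N.
Proof. by rewrite cardsCs finset.setCK card_ord -s_def; exact: le_sub_of_double_le. Qed.

Let x := K ^+ 2 * lambda_init * ss.
Let x0 : 0 < x. Proof. by rewrite !mulr_gt0. Qed.

Let init_error j : `|(binit - beta) j 0| <= 3 * x.
Proof.
have := lasso_sup_error betaS (esym s_def) s_gt0 s_le_compl lambda_init0 K2_0
  score_lambda cone_bound init j.
by rewrite /x !mulrA.
Qed.

Let B_x : 16 * (3 * x) <= B.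
Proof.
apply: (signal_vs_init_error (eta := eta) (M := M) (r3 := Num.sqrt 3)) => //.
by rewrite sqr_sqrtr.
Qed.

Let init_large k : k \in S -> 15 / 16 * B <= `|binit k 0|.
Proof.
move=> kS; have := beta_large kS; have := init_error k; rewrite col_subE => H1 H2.
have := ler_normB (binit k 0) (binit k 0 - beta k 0); rewrite subKr.
by move: B_x; lra.
Qed.

Let init_selected k : k \in S -> 4 * lambda_init < `|binit k 0|.
Proof.
move=> kS; apply: lt_le_trans (init_large kS).
have ss1 : 1 <= ss by rewrite -[leLHS]sqrtr1 ler_wsqrtr// ler1n.
have lx : 2 * lambda_init <= x.
  have l2 : 2 * lambda_init <= K ^+ 2 * lambda_init by rewrite ler_pM2r.
  apply: le_trans l2 _; rewrite /x ler_peMr//.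
  by rewrite mulr_ge0 ?ltW.
by move: lambda_init0 B_x; lra.
Qed.

Let sbar_bounds : s%:R <= sbar%:R :> R /\ sbar%:R <= s%:R * (1 + 9 / 16 * K ^+ 2).
Proof.
rewrite sbar_def; exact: (lasso_selected_bounds betaS (esym s_def) s_gt0
  s_le_compl lambda_init0 K2_0 score_lambda cone_bound init init_selected).
Qed.

Let ss_sb : ss <= sb. Proof. by rewrite ler_wsqrtr// (proj1 sbar_bounds). Qed.

Let sb0 : 0 < sb. Proof. exact: lt_le_trans ss_sb. Qed.

Let sb_sqr : sb ^+ 2 <= ss ^+ 2 * (1 + 9 / 16 * K ^+ 2).
Proof. by rewrite /sb ss_sqr sqr_sqrtr// (proj2 sbar_bounds). Qed.

Let scaleE : lambda_n / (c0 * sigma * lambda_init * Num.sqrt sbar%:R)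
  * Num.sqrt (n%:R / (2 * ln (p - s)%:R)) = lambda_n / (u * lambda_init * sb).
Proof.
have -> : Num.sqrt (n%:R / (2 * ln (p - s)%:R)) = r1^-1 :> R.
  have r1_ge0 : 0 <= 2 * ln (p - s)%:R / n%:R :> R.
    by rewrite divr_ge0// (le_trans _ ln_ps)//; move: lnp2; lra.
  by rewrite /r1 -sqrtrV// invf_div.
by rewrite -/cs -/sb /u; field; rewrite !lt0r_neq0.
Qed.

Let usb0 : 0 < u * lambda_init * sb. Proof. by rewrite !mulr_gt0. Qed.

Let lambda_n_lower : 64 * K ^+ 2 / eta * (u * lambda_init * sb) <= lambda_n.
Proof. by have /andP[+ _] := lambda_n_bounds; rewrite scaleE ler_pdivlMr. Qed.

Let lambda_n_upper : lambda_n <= 16 * M * K * (u * lambda_init * sb).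
Proof. by have /andP[_] := lambda_n_bounds; rewrite scaleE ler_pdivrMr. Qed.

Let W := Num.max (16 / (15 * B)) 1.

Let B0 : 0 < B. Proof. by move: B_x x0; lra. Qed.

Let lambda_n0 : 0 < lambda_n.
Proof.
by apply: (@lambda_n_gt0 _ ss sb K lambda_init lambda_n u eta).
Qed.

Let weight_ge0 j : 0 <= fine (ada_weight binit j).
Proof. by rewrite /ada_weight; case: ifP => //= _; rewrite le_max ler01 orbT. Qed.

Let weight_S k : k \in S -> (ada_weight binit k != +oo)%E /\ fine (ada_weight binit k) <= W.
Proof.
move=> kS; have b0 : 0 < `|binit k 0|.
  by apply: lt_le_trans (init_large kS); apply: mulr_gt0; [lra|exact: B0].
have bn0 : binit k 0 != 0 by rewrite -normr_gt0.
rewrite /ada_weight (negbTE bn0); split=> //=.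
rewrite /W ge_max !le_max lexx orbT andbT; apply/orP; left.
have B15 : 0 < 15 * B by apply: mulr_gt0; [exact: ltr0n|exact: B0].
rewrite ler_pdivrMr// [leRHS]mulrAC ler_pdivlMr//.
by have := init_large kS; lra.
Qed.

Let weight_out j : j \notin S -> (ada_weight binit j != +oo)%E ->
  1 <= fine (ada_weight binit j) * (3 * x).
Proof.
move=> jS; rewrite /ada_weight; case: ifPn => // bj _ /=.
have b0 : 0 < `|binit j 0| by rewrite normr_gt0.
have b_le : `|binit j 0| <= 3 * x.
  by have := init_error j; rewrite col_subE betaS// subr0.
apply: (@le_trans _ _ (1 / `|binit j 0| * (3 * x))).
  by rewrite mulrAC mul1r ler_pdivlMr// mul1r.
apply: ler_wpM2r; last by rewrite le_max lexx.
by apply: mulr_ge0 => //; exact: ltW.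
Qed.

(** With the choices made above, the signal and incoherence conditions of
    [adaptive_lasso_support] are the inequalities of the arithmetic part; in
    the second one the noise takes 9/64 of lambda_n w_j and the penalty 1/8. *)
Lemma good_sample_support : supp b = supp beta.
Proof.
have r3_0 : 0 < Num.sqrt 3 :> R by rewrite sqrtr_gt0.
have r3_sqr : Num.sqrt 3 ^+ 2 = 3 :> R by rewrite sqr_sqrtr.
have W0 : 0 <= W by rewrite le_max ler01 orbT.
apply: (adaptive_lasso_support Lambda0 sparse_bound (ltW lambda_n0) _ W0
  score_lambda weight_ge0 weight_S _ _ adaptive).
- by rewrite divr_ge0// ltW.
- move=> k kS; apply: lt_trans (beta_large kS).
  rewrite -/S -s_def -/ss -L_sqr.
  exact: (signal_arith ss0 L0 K_sqr_ge2 K0 lambda_init0 u0 eta_bounds r3_0 r3_sqr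
    ss_sb sb_sqr K_Lambda M_lower M_upper u_lambda lambda_n_lower lambda_n_upper
    B_incoherence B_M).
move=> j jS wj.
have w_j := weight_out jS wj.
have root : Num.sqrt (gram X j j / Lambda) <= c0 / L.
  have -> : c0 / L = Num.sqrt (c0 ^+ 2 / Lambda).
    by rewrite sqrtrM ?sqr_ge0// sqrtr_sqr gtr0_norm// sqrtrV// ltW.
  by rewrite ler_wsqrtr// ler_pM2r ?invr_gt0// c0_sqr.
have inc := incoherence_arith ss0 L0 K_sqr_ge2 K0 lambda_init0 eta_bounds c0_0 c0_sqr
  r3_0 r3_sqr M_lower sparsity B_incoherence B_M.
have noi := noise_arith ss0 K0 lambda_init0 u0 eta_bounds ss_sb lambda_n_lower.
have res : `|\sum_k residual_coef X beta j k 0 * score X Y beta k 0| <= 3 * u.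
  apply: le_trans (residual_small jS) _.
  rewrite -/cs (_ : 3 * u = cs * (3 * r1)); last by rewrite /u; ring.
  rewrite ler_pM2l//.
  have -> : 3 * r1 = Num.sqrt (9 * (2 * ln (p - s)%:R / n%:R)).
    by rewrite -sqrt_sqr_mul//; congr Num.sqrt; ring.
  rewrite ler_wsqrtr// !mulrA ler_pM2r ?invr_gt0//.
  by move: ln_ps lnp2; lra.
rewrite -s_def -/ss -(ltr_pM2r (_ : 0 < 3 * x)) ?mulr_gt0//.
rewrite -/x -/W in inc noi *.
apply: (@lt_le_trans _ _ lambda_n); last first.
  by rewrite -mulrA -[leLHS]mulr1 ler_pM2l.
have H1 : `|\sum_k residual_coef X beta j k 0 * score X Y beta k 0| * (3 * x) <=
    9 / 64 * lambda_n.
  by apply: le_trans noi; rewrite ler_wpM2r// mulr_ge0 ?ltW.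
have H2 : lambda_n * W * (ss * Num.sqrt (gram X j j / Lambda)) * (3 * x) <=
    lambda_n / 8.
  apply: (@le_trans _ _ (lambda_n * (3 * x * W * ss * (c0 / L)))).
    have c : 0 <= lambda_n * (3 * x * W * ss).
      by rewrite !mulr_ge0// ltW.
    by have := ler_wpM2l c root; lra.
  by have := ler_wpM2l (ltW lambda_n0) inc; lra.
by rewrite mulrDl; move: lambda_n0; lra.
Qed.

End good_sample.

(** * The probability of the good event *)

Section measurable_regression.
Context d (T : measurableType d) (R : realType).

Lemma measurable_gram n p (X : T -> 'M[R]_(n, p)) :
  measurable_mx X -> measurable_mx (fun w => gram (X w)).
Proof.
move=> mX; apply: measurable_mx_scale => //; apply: measurable_mx_mul => //.
exact: measurable_mx_tr.
Qed.

(** This makes the projected noise a linear form in eps whose coefficients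
    depend on X in a measurable way, as conditioning on X requires. *)
Lemma measurable_residual_coef n p (beta : 'cV[R]_p) j (X : T -> 'M[R]_(n, p)) :
  measurable_mx X -> measurable_mx (fun w => residual_coef (X w) beta j).
Proof.
move=> /measurable_gram mG; apply: measurable_mx_sub => //.
have mblock : measurable_mx (fun w => block_mx_on (gram (X w)) (supp beta)).
  move=> k l; have [kl|/negbTE kl] := boolP ((k \in supp beta) && (l \in supp beta)).
    by under eq_fun do rewrite mxE kl; exact: mG.
  by under eq_fun do rewrite mxE kl; exact: measurable_cst.
apply: measurable_mx_scale; first exact/measurable_funV/measurable_det.
apply: measurable_mx_mul; first exact: measurable_mx_adj.
move=> k l; have [kS|/negbTE kS] := boolP (k \in supp beta).
  under eq_fun do rewrite mxE kS; under eq_fun do rewrite mxE; exact: mG.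
by under eq_fun do rewrite mxE kS; exact: measurable_cst.
Qed.

End measurable_regression.

Lemma mx_norm_le (R : realType) m n (A : 'M[R]_(m, n)) (c : R) : 0 <= c ->
  (forall i j, `|A i j| <= c) -> mx_norm A <= c.
Proof.
move=> c0 Ac; have [->//|/mx_norm_neq0 [[i j] ->]] := eqVneq (mx_norm A) 0.
exact: Ac.
Qed.

(** The three terms are the failure probabilities of the three families; the
    first one has the spare factor x^(-4/9), which is at most 1/8 because
    8^9 <= 128^4. *)
Lemma failure_budget (R : realType) (x : R) : 213 <= x ->
  x * x * (4 * expR (- (40 / 9 * ln x))) + x * (2 * expR (- (6 / 2 * ln x))) +
    x * (2 * expR (- (8 / 2 * ln x))) <= 3 / x ^+ 2.
Proof.
move=> x_ge; have x0 : 0 < x by lra.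
have expN k : expR (- (k%:R * ln x)) = (x ^+ k)^-1.
  by rewrite expRN expRM_natl lnK.
have -> : 6 / 2 = 3%:R :> R by field.
have -> : 8 / 2 = 4%:R :> R by field.
have -> : expR (- (40 / 9 * ln x)) = (x ^+ 4)^-1 * expR (- (4 / 9 * ln x)).
  by rewrite -expN -expRD; congr expR; field.
have small : expR (- (4 / 9 * ln x)) <= 1 / 8.
  rewrite expRN mul1r lef_pV2 ?posrE ?expR_gt0//.
  rewrite -(@ler_pXn2r _ 9) ?nnegrE ?expR_ge0// -expRM_natl.
  have -> : 9%:R * (4 / 9 * ln x) = 4%:R * ln x by field.
  rewrite expRM_natl lnK//.
  have pow8 : 8 = 2 ^+ 3 :> R by ring.
  have pow128 : 128 = 2 ^+ 7 :> R by ring.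
  apply: (@le_trans _ _ (128 ^+ 4)).
    by rewrite pow8 pow128 -!exprM ler_eXn2l ?ltr1n.
  by apply: lerXn2r; rewrite ?nnegrE ?(ltW x0)//; lra.
rewrite !expN.
have x4 : 0 < (x ^+ 4)^-1 by rewrite invr_gt0 exprn_gt0.
have H1 : x * x * (4 * ((x ^+ 4)^-1 * expR (- (4 / 9 * ln x)))) <= 1 / 2 / x ^+ 2.
  have -> : 1 / 2 / x ^+ 2 = x * x * (4 * ((x ^+ 4)^-1 * (1 / 8))).
    by field; exact: lt0r_neq0.
  by rewrite !ler_pM2l ?mulr_gt0.
have H2 : x * (2 * (x ^+ 3)^-1) = 2 / x ^+ 2 by field; exact: lt0r_neq0.
have H3 : x * (2 * (x ^+ 4)^-1) <= 1 / 2 / x ^+ 2.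
  have -> : x * (2 * (x ^+ 4)^-1) = 2 / x / x ^+ 2 by field; exact: lt0r_neq0.
  rewrite ler_pM2r ?invr_gt0 ?exprn_gt0// ler_pdivrMr//; lra.
rewrite H2; move: H1 H3; lra.
Qed.

Section good_event.
Context d (T : measurableType d) (R : realType) (P : probability T R).
Variables (n p : nat) (beta : 'cV[R]_p) (Sigma : 'M[R]_p) (sigma Lambda : R)
  (X : T -> 'M[R]_(n, p)) (eps : T -> 'cV[R]_n) (Y : T -> 'cV[R]_n).
Hypotheses (sigma_gt0 : 0 < sigma) (rowsX : iid_gaussian_rows P Sigma X)
  (noise : centered_gaussian P ((sigma ^+ 2)%:M : 'M[R]_n) eps)
  (indep : independent2 P (sigma_generated X) (sigma_generated eps))
  (model : forall w, Y w = X w *m beta + eps w)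
  (Sigma1 : forall j, Sigma j j = 1) (n_pos : (0 < n)%N)
  (p_ge : 213 <= p%:R :> R).

Let rho := Num.sqrt (ln p%:R / n%:R) : R.
Let t := 4 * Num.sqrt (5 / 3) * rho.
Let c0 := Num.sqrt (3 / 2) : R.

Hypotheses (t_le : t <= 1 / 2) (Lambda0 : 0 < Lambda)
  (sparse : forall A : 'M[R]_(n, p), (forall j k, `|gram A j k - Sigma j k| <= t) ->
    forall g : 'cV[R]_p, (forall j, j \notin supp beta -> g j 0 = 0) ->
      Lambda * \sum_j g j 0 ^+ 2 <= quadform (gram A) g).

Let close : set T := [set w | forall j k, `|gram (X w) j k - Sigma j k| <= t].

Let mX : measurable_mx X.
Proof. by move=> i j; exact: (gaussian_design_entry_measurable rowsX). Qed.

Let T1 := g_sigma_algebraType (entry_events X).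

Let mX1 : measurable_mx (X : T1 -> 'M[R]_(n, p)).
Proof. by move=> i j; exact: entry_measurable_generated. Qed.

Let n0 : (0 : R) < n%:R. Proof. by rewrite ltr0n. Qed.
Let lnp0 : 0 <= ln p%:R :> R. Proof. by rewrite ln_ge0//; move: p_ge; lra. Qed.
Let t0 : 0 <= t. Proof. by rewrite !mulr_ge0 ?sqrtr_ge0. Qed.

Let p0 : (0 : R) < p%:R. Proof. by move: p_ge; lra. Qed.

Let gram_entry_scaled (A : 'M[R]_(n, p)) j k : gram A j k = n%:R^-1 * (A^T *m A) j k.
Proof. by rewrite mxE. Qed.

Let mclose : measurable (close : set T1).
Proof.
rewrite (_ : close = ~` [set w | exists jk : 'I_p * 'I_p,
    t < `|gram (X w) jk.1 jk.2 - Sigma jk.1 jk.2|]).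
  apply: measurableC; apply: measurable_exists => -[j k].
  apply: measurable_gt_norm; apply: measurable_funB => //.
  exact: (measurable_gram mX1).
apply/seteqP; split=> w /=.
  by move=> cl [[j k]/=]; rewrite ltNge cl.
by move=> H j k; rewrite leNgt; apply/negP => B; apply: H; exists (j, k).
Qed.

Let far jk : set T := [set w | n%:R * t <
  `|((X w)^T *m X w) jk.1 jk.2 - n%:R * Sigma jk.1 jk.2|].

(* The exponent is n t^2 / 6 with n t^2 = (80 / 3) ln p. *)
Let far_tail (jk : 'I_p * 'I_p) : (P (far jk) <= (4 * expR (- (40 / 9 * ln p%:R)))%:E)%E.
Proof.
have tb : 0 <= t <= 1 / 2 by rewrite t0 t_le.
apply: le_trans (gram_entry_tail rowsX Sigma1 n_pos jk.1 jk.2 tb) _.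
rewrite lee_fin ler_wpM2l// ler_expR lerN2 /t !exprMn.
have -> : rho ^+ 2 = ln p%:R / n%:R by rewrite sqr_sqrtr ?divr_ge0// ltW.
have -> : Num.sqrt (5 / 3) ^+ 2 = 5 / 3 :> R by rewrite sqr_sqrtr// divr_ge0.
by rewrite le_eqVlt; apply/orP; left; apply/eqP; field; exact: lt0r_neq0.
Qed.

(* The direction r may depend on X; it will be a basis vector or the residual
   of a column, and a is 6 or 8. *)
Let deviant (r : T -> 'cV[R]_p) (a : R) : set T := [set w | close w /\
  c0 * sigma * Num.sqrt (a * ln p%:R / n%:R) <
    `|\sum_k r w k 0 * score (X w) (Y w) beta k 0|].

Let scoreE w (r : 'cV[R]_p) : \sum_k r k 0 * score (X w) (Y w) beta k 0 =
  ((n%:R^-1 *: (X w *m r))^T *m eps w) 0 0.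
Proof.
have -> : (n%:R^-1 *: (X w *m r))^T = n%:R^-1 *: (r^T *m (X w)^T).
  by rewrite -trmx_mul; apply/matrixP => i j; rewrite !mxE.
rewrite -linear_form_sum /score model addrC addKr.
by rewrite -scalemxAr -scalemxAl mulmxA.
Qed.

Let mscore j : measurable_fun setT (fun w => score (X w) (Y w) beta j 0).
Proof.
have meps : measurable_mx eps.
  by move=> i k; rewrite (ord1 k); exact: (noise_entry_measurable noise).
have : measurable_mx (fun w => n%:R^-1 *: ((X w)^T *m eps w)).
  apply: measurable_mx_scale => //; apply: measurable_mx_mul => //.
  exact: measurable_mx_tr.
move=> /(_ j 0); congr measurable_fun; apply/funext => w.
by rewrite /score model addrC addKr.
Qed.

Let mcloseT : measurable close.
Proof. exact: (measurable_generated (entry_events_measurable mX)). Qed.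

Let deviant_measurable r a : measurable_mx r -> measurable (deviant r a).
Proof.
move=> mr; apply: measurableI => //; apply: measurable_gt_norm.
by apply: measurable_sum => k; apply: measurable_funM.
Qed.

Let deviant_tail (r : T -> 'cV[R]_p) (a : R) : 0 <= a ->
  measurable_mx (r : T1 -> 'cV[R]_p) ->
  (forall w, close w -> quadform (gram (X w)) (r w) <= 3 / 2) ->
  (P (deviant r a) <= (2 * expR (- (a / 2 * ln p%:R)))%:E)%E.
Proof.
move=> a0 mr rq; pose V := sigma ^+ 2 * (3 / 2) / n%:R.
have V0 : 0 < V by rewrite divr_gt0// mulr_gt0 ?exprn_gt0// divr_gt0.
pose tau := c0 * sigma * Num.sqrt (a * ln p%:R / n%:R).
have tau0 : 0 <= tau by rewrite !mulr_ge0 ?sqrtr_ge0// ltW.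
have q0 : 0 <= a * ln p%:R / n%:R.
  by apply: divr_ge0; [exact: mulr_ge0|exact: ltW].
have -> : a / 2 * ln p%:R = tau ^+ 2 / (2 * V).
  have c2 : c0 ^+ 2 = 3 / 2 by rewrite sqr_sqrtr// divr_ge0.
  by rewrite /tau /V !exprMn c2 sqr_sqrtr//; field; rewrite !lt0r_neq0.
pose v w := n%:R^-1 *: (X w *m r w).
have -> : deviant r a = [set w | close w /\ tau < `|((v w)^T *m eps w) 0 0|].
  by apply/seteqP; split=> w; rewrite /deviant /= scoreE.
apply: (conditional_noise_tail mX noise indep) => //.
- move=> i; apply: (measurable_mx_scale (c := cst n%:R^-1)) => //.
  exact: measurable_mx_mul.
- move=> w /rq H; rewrite -sqr_l2norm.
  have -> : l2norm (v w) ^+ 2 = n%:R^-1 * quadform (gram (X w)) (r w).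
    rewrite quadform_gram mulrA -expr2 !sqr_l2norm mulr_sumr.
    by apply: eq_bigr => i _; rewrite [v w i 0]mxE exprMn.
  rewrite /V -mulrA ler_wpM2l ?sqr_ge0// mulrC ler_wpM2r// invr_ge0 ltW//.
Qed.

Let gram_diag w j : close w -> gram (X w) j j <= 3 / 2.
Proof.
by move=> /(_ j j); rewrite Sigma1 ler_norml; move: t_le; lra.
Qed.

Lemma good_event : exists E : set T, [/\ measurable E,
  ((1 - 3 / p%:R ^+ 2)%:E <= P E)%E &
  forall w, E w -> [/\ forall j k, `|gram (X w) j k - Sigma j k| <= t,
    forall j, `|score (X w) (Y w) beta j 0| <=
      c0 * sigma * Num.sqrt (6 * ln p%:R / n%:R) &
    forall j, `|\sum_k residual_coef (X w) beta j k 0 * score (X w) (Y w) beta k 0| <=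
      c0 * sigma * Num.sqrt (8 * ln p%:R / n%:R)]].
Proof.
pose U1 := [set w | exists jk, far jk w].
pose U2 := [set w | exists j, deviant (fun=> delta_mx j 0) 6 w].
pose U3 := [set w | exists j, deviant (fun w => residual_coef (X w) beta j) 8 w].
have mfar jk : measurable (far jk).
  apply: measurable_gt_norm; exact: (gram_entry_measurable rowsX).
have mdelta j : measurable_mx ((fun=> delta_mx j 0) : T1 -> 'cV[R]_p).
  by move=> i k; exact: measurable_cst.
have mdev2 j : measurable (deviant (fun=> delta_mx j 0) 6).
  by apply: deviant_measurable => i k; exact: measurable_cst.
have mdev3 j : measurable (deviant (fun w => residual_coef (X w) beta j) 8).
  by apply: deviant_measurable; exact: measurable_residual_coef.
have PU1 := union_bound mfar far_tail.
have PU2 : (P U2 <= (#|'I_p|%:R * (2 * expR (- (6 / 2 * ln p%:R))))%:E)%E.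
  apply: union_bound => // j; apply: deviant_tail => // w cl.
  by rewrite /quadform bilinear_delta gram_diag.
have PU3 : (P U3 <= (#|'I_p|%:R * (2 * expR (- (8 / 2 * ln p%:R))))%:E)%E.
  apply: union_bound => // j; apply: deviant_tail => //.
    exact: measurable_residual_coef.
  move=> w cl; apply: le_trans (gram_diag j cl).
  exact: (quadform_residual_le Lambda0 (sparse cl)).
have mU1 : measurable U1 by exact: measurable_exists.
have mU2 : measurable U2 by exact: measurable_exists.
have mU3 : measurable U3 by exact: measurable_exists.
have mU : measurable (U1 `|` U2 `|` U3) by do 2 apply: measurableU => //.
exists (~` (U1 `|` U2 `|` U3)); split.
- exact: measurableC.
- rewrite probability_setC// EFinB leeB//.
  apply: le_trans (measureU2 _ _ _) _ => //; first exact: measurableU.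
  apply: le_trans (leeD (measureU2 _ _ _) (lexx _)) _ => //.
  apply: le_trans (leeD (leeD PU1 PU2) PU3) _.
  by rewrite -!EFinD lee_fin card_prod card_ord natrM failure_budget.
- move=> w; rewrite /U1 /U2 /U3 /= => H.
  have cl j k : `|gram (X w) j k - Sigma j k| <= t.
    rewrite leNgt; apply/negP => B; apply: H; left; left; exists (j, k).
    have E : ((X w)^T *m X w) j k - n%:R * Sigma j k = n%:R * (gram (X w) j k - Sigma j k).
      by rewrite gram_entry_scaled mulrBr mulVKf// gt_eqF.
    by rewrite /far/= E normrM gtr0_norm// ltr_pM2l.
  split=> //.
  + move=> j; rewrite leNgt; apply/negP => B; apply: H; left; right; exists j.
    split=> //; rewrite (bigD1 j)//= mxE !eqxx mul1r big1 ?addr0// => k kj.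
    by rewrite mxE (negbTE kj) mul0r.
  + move=> j; rewrite leNgt; apply/negP => B; apply: H; right; exists j.
    by split.
Qed.

End good_event.

(** * Variable selection consistency *)

Theorem theorem5p3 (R : realType) (d : measure_display) (T : measurableType d)
  (P : probability T R) (n p : nat)
  (beta : 'cV[R]_p) (Sigma : 'M[R]_p) (sigma C2 : R)
  (X : T -> 'M[R]_(n, p)) (eps : T -> 'cV[R]_n) (Y : T -> 'cV[R]_n)
  (* the linear model *)
  (sigma_gt0 : 0 < sigma)
  (rowsX : iid_gaussian_rows P Sigma X)
  (noise : centered_gaussian P ((sigma ^+ 2)%:M : 'M[R]_n) eps)
  (indep : independent2 P (sigma_generated X) (sigma_generated eps))
  (model : forall w, Y w = X w *m beta + eps w)
  (n_le_p : (n <= p)%N)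
  (p_lt : p%:R < expR (n%:R / (4 * C2 ^+ 2)))
  (C2_gt : 4 * Num.sqrt (5 / 3) < C2)
  (* constants and the restricted eigenvalue assumption *)
  (s : nat) (s_def : s = #|supp beta|)
  (RE : RE_assumption (supp beta) s s 3 Sigma)
  (K c0 lambda_init : R)
  (K_def : K = Num.sqrt 2 * RE_K s s 3 Sigma)
  (c0_def : c0 = Num.sqrt (3 / 2))
  (lambda_init_def :
    lambda_init = Num.sqrt 24 * c0 * sigma * Num.sqrt (ln p%:R / n%:R))
  (* the initial estimator *)
  (beta_init : T -> 'cV[R]_p)
  (beta_init_lasso : forall w, is_lasso (X w) (Y w) lambda_init (beta_init w))
  (sbar : T -> nat)
  (sbar_def : forall w,
    sbar w = #|[set j | (4 * lambda_init < `|beta_init w j 0|)%R]%SET|)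
  (* the tuning parameter, possibly data-dependent *)
  (eta M : R) (lambda_n : T -> R)
  (eta_bounds : 0 < eta < 1)
  (M_bounds : 4 * K / eta <= M <=
    Num.sqrt (Lambda_min Sigma s) / ((1 - eta) * c0 * sigma)
      * Num.sqrt (n%:R / (2 * ln p%:R)))
  (lambda_n_bounds : forall w, (event_X X Sigma C2 `&` event_T X eps c0 sigma) w ->
    64 * K ^+ 2 / eta <=
      lambda_n w / (c0 * sigma * lambda_init * Num.sqrt (sbar w)%:R)
        * Num.sqrt (n%:R / (2 * ln (p - s)%:R))
      <= 16 * M * K)
  (* sparsity and beta-min conditions *)
  (s_le : s%:R <= 1 / (32 * RE_K s s 3 Sigma ^+ 2)
    * Num.min (1 / C2)
        (Num.sqrt (Lambda_min Sigma s) * (1 - eta) / (6 * Num.sqrt 6 * sigma))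
    * Num.sqrt (n%:R / ln p%:R))
  (beta_min_gt :
    Num.max (2 * Num.sqrt s%:R / ((1 - eta) * Num.sqrt (Lambda_min Sigma s)))
            (M / Num.sqrt 3)
      * 16 * K ^+ 2 * lambda_init * Num.sqrt s%:R < beta_min beta)
  (* the adaptive Lasso estimator *)
  (beta_hat : T -> 'cV[R]_p)
  (beta_hat_lasso : forall w, is_adaptive_lasso (X w) (Y w) (lambda_n w)
    (ada_weight (beta_init w)) (beta_hat w)) :
  with_probability_at_least P (1 - 3 / p%:R ^+ 2)
    [set w | supp (beta_hat w) = supp beta].
Proof.
have s_gt0 := RE_s_gt0 RE; have s_half := RE_s_half RE.
have n_pos : (0 < n)%N := sample_size_gt0 s_gt0 s_half n_le_p p_lt C2_gt.
have p_ge : 213 <= p%:R :> R := dimension_ge213 s_gt0 s_half n_le_p p_lt C2_gt.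
have psd : is_psd Sigma := (rowsX.1 (Ordinal n_pos)).1.
pose rho : R := Num.sqrt (ln p%:R / n%:R).
have rho0 : 0 < rho.
  rewrite sqrtr_gt0 divr_gt0 ?ltr0n//.
  by have := ln_p_ge2 s_gt0 s_half n_le_p p_lt C2_gt; lra.
pose t := 4 * Num.sqrt (5 / 3) * rho.
have t0 : 0 <= t by rewrite !mulr_ge0 ?sqrtr_ge0.
have Lambda0 : 0 < Lambda_min Sigma s.
  by have : 0 < 17 * Lambda_min Sigma s / 16 := RE_Lambda_gt0 RE; lra.
have [E [mE PE good]] := good_event sigma_gt0 rowsX noise indep model (RE_diag RE)
  n_pos p_ge (deviation_le_half n_le_p p_lt C2_gt RE) Lambda0
  (fun A cl g gS => gram_sparse_bound psd RE t0 cl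
    (sparsity_deviation n_le_p p_lt C2_gt RE s_le) (eq_leq (esym s_def)) gS).
exists E => //; split=> // w /good [close score_le residual_le].
have on_X : event_X X Sigma C2 w.
  apply: (@le_lt_trans _ _ t); last by rewrite /t ltr_pM2r.
  by apply: mx_norm_le => // j k; have := close j k; rewrite /gram !mxE.
have on_T : event_T X eps c0 sigma w.
  have bound0 : 0 <= c0 * sigma * Num.sqrt (6 * ln p%:R / n%:R).
    by rewrite c0_def !mulr_ge0 ?sqrtr_ge0 ?(ltW sigma_gt0).
  apply: mx_norm_le => // j k; rewrite (ord1 k) c0_def.
  by have := score_le j; rewrite /score model addrC addKr.
rewrite -c0_def in score_le residual_le.
exact: (good_sample_support sigma_gt0 psd n_le_p p_lt C2_gt s_def RE K_def c0_def
  lambda_init_def eta_bounds M_bounds s_le beta_min_gt (beta_init_lasso w)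
  (sbar_def w) (lambda_n_bounds w (conj on_X on_T)) (beta_hat_lasso w) close score_le
  (fun j _ => residual_le j)).
Qed.
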